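(* Let $q$ be real-valued and suppose either $b<\infty$, $q\in L^1((0,b))$ with a boundary condition $u'(b_-)+hu(b_-)=0$, $h\in\mathbb R\cup\{\infty\}$, at $b$; or $b=\infty$ and $q\in L^1((0,\infty))$. Let $d\rho$ be the associated spectral measure. Let $f\in C_0^\infty(\mathbb R)$ with $f(-\alpha)=-f(\alpha)$ for all $\alpha\in\mathbb R$. Then $$-2\int_{\mathbb R}\left[\int_{-\infty}^\infty f(\alpha)\frac{\sin(2\alpha\sqrt\lambda)}{\sqrt\lambda}\,d\alpha\right]d\rho(\lambda)=\int_{-\infty}^\infty\tilde A(\alpha)f(\alpha)\,d\alpha,$$ where $\tilde A$ is the distribution $$\tilde A(\alpha)=\chi_{(0,\infty)}(\alpha)A(\alpha)-\chi_{(-\infty,0)}(\alpha)A(-\alpha)+\delta'(\alpha)$$ if $b=\infty$, and $$\tilde A(\alpha)=\chi_{(0,\infty)}(\alpha)A(\alpha)-\chi_{(-\infty,0)}(\alpha)A(-\alpha)+\delta'(\alpha)+\sum_{j=1}^\infty B_j[\delta(\alpha-bj)-\delta(\alpha+bj)]+\sum_{j=1}^\infty\tfrac12A_j[\delta'(\alpha-bj)+\delta'(\alpha+bj)]$$ if $b<\infty$, with $A$, $A_j$, $B_j$ as defined in the context.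
   Context: $m$-function: for $\operatorname{Im}z>0$, $m(z)=u'(0_+,z)/u(0_+,z)$, where $u(\cdot,z)$ is a nonzero solution of $-u''+qu=zu$ satisfying the boundary condition at $b$ if $b<\infty$ ($h=\infty$ means $u(b_-)=0$), and $u(\cdot,z)\in L^2((0,\infty))$ if $b=\infty$. It extends analytically to $\mathbb C\setminus[\beta,\infty)$ for some $\beta\in\mathbb R$. Spectral measure: $\rho$ is the positive measure with $m(z)=\operatorname{Re}(m(i))+\int_{\mathbb R}\left[\frac1{\lambda-z}-\frac{\lambda}{1+\lambda^2}\right]d\rho(\lambda)$. $A$ for $b=\infty$: the function on $(0,\infty)$ with $m(-\kappa^2)=-\kappa-\int_0^\infty A(\alpha)e^{-2\alpha\kappa}\,d\alpha$ for $\operatorname{Re}\kappa>\frac12\|q\|_1$. $A,A_j,B_j$ for $b<\infty$: for $\operatorname{Re}\kappa$ sufficiently large, $$m(-\kappa^2)=-\kappa-\sum_{j=1}^\infty A_j\kappa e^{-2\kappa bj}-\sum_{j=1}^\infty B_je^{-2\kappa bj}-\int_0^\infty A(\alpha)e^{-2\alpha\kappa}\,d\alpha,$$ where $A\in L^1((0,a))$ for all $a<\infty$ with at most exponential growth of $\int_0^a|A|$, and: if $h=\infty$, $A_j=2$, $B_j=-2j\int_0^bq(x)\,dx$; if $|h|<\infty$, $A_j=2(-1)^j$, $B_j=2(-1)^{j+1}j\left[2h+\int_0^bq(x)\,dx\right]$. (The existence of these representations is known.) Convention: $\lambda^{-1/2}\sin(2\alpha\sqrt\lambda)$ denotes the entire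 extension in $\lambda$: it equals $2\alpha$ at $\lambda=0$ and $(-\lambda)^{-1/2}\sinh(2\alpha\sqrt{-\lambda})$ for $\lambda<0$. *)

(* Defs.v *)
From HB Require Import structures.
From mathcomp Require Import all_boot all_order all_algebra.
From mathcomp Require Import complex.
From mathcomp Require Import all_classical all_reals all_analysis.

Set Implicit Arguments.
Unset Strict Implicit.
Unset Printing Implicit Defensive.

Import Order.TTheory GRing.Theory Num.Theory numFieldNormedType.Exports.

Local Open Scope classical_set_scope.
Local Open Scope complex_scope.
Local Open Scope ring_scope.

(* Complex numbers are [R[i]]; [complex.Re] and [complex.Im] are the real-valued
   parts. Limits and complex derivatives use the normed module [R[i]^o] over
   the field [R[i]]. Derivatives in a real variable and Lebesgue integrals of
   [R[i]]-valued functions are taken on real and imaginary parts. *)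

Section ComplexValued.
Variable R : realType.
Implicit Types (u : R -> R[i]) (z d : R[i]).

Definition cexp z : R[i] :=
  (expR (complex.Re z) * cos (complex.Im z)) +i*
  (expR (complex.Re z) * sin (complex.Im z)).

Definition Re_fun u : R -> R := fun x => complex.Re (u x).
Definition Im_fun u : R -> R := fun x => complex.Im (u x).

Definition is_cderive u (x : R) d : Prop :=
  is_derive x 1 (Re_fun u) (complex.Re d) /\
  is_derive x 1 (Im_fun u) (complex.Im d).

Definition cderive u : R -> R[i] :=
  fun x => ((Re_fun u)^`())%classic x +i* ((Im_fun u)^`())%classic x.

Definition csmooth u : Prop :=
  forall (n : nat) (x : R),
    derivable ((Re_fun u)^`(n))%classic x 1 /\
    derivable ((Im_fun u)^`(n))%classic x 1.

Definition cintegrable (mu : {measure set (measurableTypeR R) -> \bar R})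
    (D : set R) u : Prop :=
  mu.-integrable D (EFin \o Re_fun u) /\ mu.-integrable D (EFin \o Im_fun u).

Definition cintegral (mu : {measure set (measurableTypeR R) -> \bar R})
    (D : set R) u : R[i] :=
  Rintegral mu D (Re_fun u) +i* Rintegral mu D (Im_fun u).

(* The sum over j >= 1. *)
Definition cseries (a : nat -> R[i]) : R[i] :=
  limn (fun n => \sum_(1 <= j < n) a j : R[i]^o).

Definition abs_continuous (c d : R) u : Prop :=
  forall e : R, 0 < e -> exists2 del : R, 0 < del &
    forall (n : nat) (s t : nat -> R),
      (forall i, (i < n)%N -> [/\ c <= s i, s i <= t i & t i <= d]) ->
      trivIset `I_n (fun i => `]s i, t i[%classic) ->
      \sum_(i < n) (t i - s i) < del ->
      \sum_(i < n) ComplexField.Normc.normc (u (t i) - u (s i)) < e.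

End ComplexValued.

Section Schrodinger.
Variable R : realType.
Local Notation leb := (@lebesgue_measure R).

(* The right endpoint b with its boundary condition:
   [Infinite]: b = oo;
   [Finite b (Some h)]: u'(b-) + h u(b-) = 0;
   [Finite b None]: h = oo, i.e. u(b-) = 0. *)
Inductive right_end : Type :=
| Infinite
| Finite of R & option R.

Implicit Types (e : right_end) (q A : R -> R) (m : R[i] -> R[i]).
Implicit Types (u du f : R -> R[i]) (z kappa : R[i]).

Definition right_end_ok e : Prop := if e is Finite b _ then 0 < b else True.

Definition dom e : set R :=
  match e with Infinite => `]0, +oo[ | Finite b _ => `]0, b[ end.

Definition L1_potential e q : Prop := leb.-integrable (dom e) (EFin \o q).

(* [du] is u'. As q is only in L^1, u' is locally absolutely continuous and
   the equation holds almost everywhere. *)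
Definition solution e q z u du : Prop :=
  [/\ forall x, dom e x -> is_cderive u x (du x),
      forall c d, `[c, d] `<=` dom e -> abs_continuous c d du
    & {ae leb, forall x, dom e x ->
        exists2 d2u, is_cderive du x d2u & - d2u + (q x)%:C * u x = z * u x}].

Definition right_condition e u du : Prop :=
  match e with
  | Infinite =>
      leb.-integrable (dom e)
        (fun x => (ComplexField.Normc.normc (u x) ^+ 2)%:E)
  | Finite b None => (u x : R[i]^o) @[x --> b^'-] --> (0 : R[i]^o)
  | Finite b (Some h) => exists ub dub : R[i]^o,
      [/\ (u x : R[i]^o) @[x --> b^'-] --> ub,
          (du x : R[i]^o) @[x --> b^'-] --> dub
        & dub + h%:C * ub = 0]
  end.

Definition m_value e q z (w : R[i]) : Prop :=
  exists (u du : R -> R[i]) (u0 du0 : R[i]^o),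
    [/\ solution e q z u du,
        (exists2 x, dom e x & u x != 0),
        right_condition e u du,
        (u x : R[i]^o) @[x --> 0^'+] --> u0 /\
        (du x : R[i]^o) @[x --> 0^'+] --> du0
      & u0 != 0 /\ w = du0 / u0].

Definition is_m_function e q m : Prop :=
  (forall z, 0 < complex.Im z -> m_value e q z (m z)) /\
  exists beta : R, forall z, ~ (complex.Im z = 0 /\ beta <= complex.Re z) ->
    derivable (m : R[i]^o -> R[i]^o) (z : R[i]^o) 1.

Definition herglotz_kernel z (lambda : R) : R[i] :=
  (lambda%:C - z)^-1 - (lambda / (1 + lambda ^+ 2))%:C.

Definition is_spectral_measure m
    (rho : {measure set (measurableTypeR R) -> \bar R}) : Prop :=
  forall z, 0 < complex.Im z ->
    cintegrable rho setT (herglotz_kernel z) /\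
    m z = (complex.Re (m (0 +i* 1)))%:C + cintegral rho setT (herglotz_kernel z).

Definition A_coef (h : option R) (j : nat) : R :=
  if h is Some _ then 2 * (-1) ^+ j else 2.

Definition B_coef q (b : R) (h : option R) (j : nat) : R :=
  let Q := Rintegral leb `]0, b[ q in
  if h is Some h' then 2 * (-1) ^+ j.+1 * j%:R * (2 * h' + Q)
  else - 2 * j%:R * Q.

Definition laplace_integrand A kappa (alpha : R) : R[i] :=
  (A alpha)%:C * cexp (- 2%:R * alpha%:C * kappa).

(* In the finite case both series converge absolutely once 0 < Re kappa, and
   the growth bound makes the Laplace integral converge absolutely for
   Re kappa large. *)
Definition is_A_function e q m A : Prop :=
  match e with
  | Infinite =>
      forall kappa,
        2^-1 * Rintegral leb (dom e) (fun x => `|q x|) < complex.Re kappa ->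
        cintegrable leb `]0, +oo[ (laplace_integrand A kappa) /\
        m (- kappa ^+ 2) =
          - kappa - cintegral leb `]0, +oo[ (laplace_integrand A kappa)
  | Finite b h =>
      [/\ forall a, 0 < a -> leb.-integrable `]0, a[ (EFin \o A),
          (exists C K : R, forall a, 0 < a ->
             Rintegral leb `]0, a[ (fun x => `|A x|) <= C * expR (K * a))
        & exists K : R, forall kappa, K < complex.Re kappa ->
            m (- kappa ^+ 2) =
              - kappa
              - cseries (fun j => (A_coef h j)%:C * kappa *
                                  cexp (- 2%:R * kappa * b%:C * j%:R))
              - cseries (fun j => (B_coef q b h j)%:C *
                                  cexp (- 2%:R * kappa * b%:C * j%:R))
              - cintegral leb `]0, +oo[ (laplace_integrand A kappa)]
  end.

(* Distributions, as functionals on test functions. *)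

Definition test_function f : Prop :=
  compact (closure [set x | f x != 0]) /\ csmooth f.

Definition distr : Type := (R -> R[i]) -> R[i].

Definition regular_distr (g : R -> R) : distr :=
  fun f => cintegral leb setT (fun alpha => (g alpha)%:C * f alpha).

(* [delta c] is delta(alpha - c). *)
Definition delta (c : R) : distr := fun f => f c.

Definition distr_derive (T : distr) : distr := fun f => - T (cderive f).

Definition delta' (c : R) : distr := distr_derive (delta c).

Definition A_tilde e q A : distr := fun f =>
  regular_distr (fun alpha => \1_(`]0, +oo[ : set R) alpha * A alpha
                            - \1_(`]-oo, 0[ : set R) alpha * A (- alpha)) f
  + delta' 0 f
  + match e with
    | Infinite => 0
    | Finite b h =>
        cseries (fun j => (B_coef q b h j)%:C *
                   (delta (b * j%:R) f - delta (- (b * j%:R)) f))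
      + cseries (fun j => (2^-1 * A_coef h j)%:C *
                   (delta' (b * j%:R) f + delta' (- (b * j%:R)) f))
    end.

(* sin(2 alpha sqrt lambda) / sqrt lambda, extended to all real lambda. *)
Definition sin_kernel (alpha lambda : R) : R :=
  if 0 < lambda then
    sin (2 * alpha * Num.sqrt lambda) / Num.sqrt lambda
  else if lambda == 0 then 2 * alpha
  else let s := Num.sqrt (- lambda) in
    (expR (2 * alpha * s) - expR (- (2 * alpha * s))) / 2 / s.

Definition sin_transform f (lambda : R) : R[i] :=
  cintegral leb setT (fun alpha => f alpha * (sin_kernel alpha lambda)%:C).

End Schrodinger.

Arguments Infinite {R}.

(* Main.v *)
Require Import Defs.
From HB Require Import structures.
From mathcomp Require Import all_boot all_order all_algebra.
From mathcomp Require Import complex.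
From mathcomp Require Import all_classical all_reals all_analysis.
From mathcomp Require Import measurable_realfun.
From mathcomp Require Import ring lra.

Set Implicit Arguments.
Unset Strict Implicit.
Unset Printing Implicit Defensive.

Import Order.TTheory GRing.Theory Num.Theory numFieldNormedType.Exports.

Local Open Scope classical_set_scope.
Local Open Scope complex_scope.
Local Open Scope ring_scope.

(* Both sides of the identity, divided by two and moved to one side, form a linear
   functional T of a real test function F on [0, +oo[; it is corrected by a
   multiple of F(0), invisible on odd F, so as to contain the same divergent part
   as the Herglotz formula. On F = exp (- 2 n x) the equation T F = 0 is the
   representation of m (- n ^ 2), because the Laplace transform of
   sin (2 x sqrt l) / sqrt l at 2 n is 1 / (2 (n ^ 2 + l)). Since m (- k ^ 2) is
   real for large real k, rho vanishes on some half-line ]-oo, - K ^ 2[, and then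
   repeated integration by parts bounds T F by the sup norms of F and its first
   four derivatives with weight exp (2 N x), N > K. Substituting y = exp (- 2 x)
   turns Bernstein's theorem on [0, 1] into the density of the exponentials
   exp (- 2 n x), n >= N, in these norms, so T F = 0 for all F of compact support.
   Real and imaginary parts are treated separately. *)

(** * Bernstein approximation of Lipschitz functions *)

(** The half-line without mass is essential: for [l < 0] the kernel grows like
    [exp (2 x sqrt (- l))], so no fixed weight [exp (2 N x)] could control it for [l] unbounded
    below. On the remaining half-line the available information on [rho] is that [(1 + l ^ 2)^-1] is
    integrable, hence transforms have to decay like [l ^ -2]. Each double integration by parts gains
    one power of [l] and leaves a boundary term, the first one proportional to [F(0)]. Exponentials
    have [F(0) = 1]; their slowly decaying part is cancelled by the same term [l / (1 + l ^ 2)] that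
    occurs in the Herglotz kernel, and the constant [Re m(i)] of the Herglotz formula also travels
    with [F(0)]. Integer exponents make the exponentials monomials in [y], and a large [N] puts the
    points [- n ^ 2] to the left of the spectrum. Functionals are bounded and linear on a prescribed
    domain, because measurability of a transform in [l] is itself obtained from the explicit
    transforms of exponentials. The terms due to a finite endpoint are kept as an abstract
    functional [W], so that both cases share one argument. *)

Section Weierstrass.
Variable R : realType.

(* Conditioning on the first of [n] Bernoulli trials gives the n-th Bernstein
   polynomial of [k |-> phi k] without binomial coefficients. *)
Fixpoint bernstein (n : nat) (phi : nat -> R) : {poly R} :=
  if n is n'.+1 then
    'X * bernstein n' (phi \o succn) + (1 - 'X) * bernstein n' phi
  else (phi 0%N)%:P.

(** For [x] in [0, 1] every step of the recursion is a convex combination, so the operator is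
    positive. *)
Lemma bernstein_le (n : nat) (phi psi : nat -> R) (x : R) : 0 <= x <= 1 ->
  (forall k, (k <= n)%N -> phi k <= psi k) ->
  (bernstein n phi).[x] <= (bernstein n psi).[x].
Proof.
move=> /andP[x0 x1]; elim: n phi psi => [|n IH] phi psi H /=.
  by rewrite !hornerC H.
rewrite !hornerE lerD// ler_wpM2l// ?subr_ge0// IH// => k kn /=; apply: H => //.
by rewrite leqW.
Qed.

(** Second moment of the binomial law: variance [n x (1 - x)] plus the squared distance of the mean
    [n x] from [c]. Shifting the argument by one replaces [c] by [c - 1], which closes the
    induction. *)
Lemma bernstein_quadratic (n : nat) (a b c x : R) :
  (bernstein n (fun k => a + b * (k%:R - c) ^+ 2)).[x] =
  a + b * (n%:R * x * (1 - x) + (n%:R * x - c) ^+ 2).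
Proof.
elim: n c => [|n IH] c /=; first by rewrite hornerC; ring.
rewrite !hornerE IH.
have -> : (fun k => a + b * (k%:R - c) ^+ 2) \o succn =
          (fun k => a + b * (k%:R - (c - 1)) ^+ 2) :> (nat -> R).
  by apply/funext => k /=; rewrite -natr1; congr (_ + _ * _ ^+ 2); ring.
by rewrite IH -natr1; ring.
Qed.

(** Bernstein's argument, with the Lipschitz bound [L |t|] replaced through AM-GM by the quadratic
    [e / 2 + L ^ 2 t ^ 2 / (2 e)]; positivity and the exact value on quadratics then control the
    error. *)
Lemma bernstein_approx (g : R -> R) (L e : R) : 0 < e ->
  (forall x y, 0 <= x <= 1 -> 0 <= y <= 1 -> `|g x - g y| <= L * `|x - y|) ->
  exists p : {poly R}, forall x, 0 <= x <= 1 -> `|g x - p.[x]| <= e.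
Proof.
move=> e0 gL.
(* This size makes the variance term [L ^ 2 x (1 - x) / (2 e n)] at most [e / 2], and the successor
   keeps [n] positive when [L = 0]. *)
pose n := (Num.trunc (L ^+ 2 / (2 * e ^+ 2))).+1.
have n0 : (0 : R) < n%:R by rewrite ltr0n.
have nL : L ^+ 2 <= n%:R * e ^+ 2 * 2.
  have /ltW : L ^+ 2 / (2 * e ^+ 2) < n%:R.
    rewrite /n; apply: truncnS_gt.
  rewrite ler_pdivrMr ?mulr_gt0 ?exprn_gt0//; lra.
pose q := L ^+ 2 / (2 * e * n%:R ^+ 2).
have q0 : 0 <= q by rewrite /q divr_ge0 ?sqr_ge0// !mulr_ge0 ?ltW// exprn_ge0// ltW.
exists (bernstein n (fun k => g (k%:R / n%:R))) => x x01.
have amgm k : (k <= n)%N ->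
    `|g (k%:R / n%:R) - g x| <= e / 2 + q * (k%:R - n%:R * x) ^+ 2.
  move=> kn; apply: (le_trans (gL _ _ _ x01)).
    by rewrite divr_ge0//= ler_pdivrMr// mul1r ler_nat.
  set t := k%:R / n%:R - x.
  have -> : k%:R - n%:R * x = n%:R * t by rewrite /t; field; rewrite gt_eqF.
  have -> : q * (n%:R * t) ^+ 2 = (L ^+ 2 * `|t| ^+ 2) / (2 * e).
    by rewrite real_normK ?num_real// /q; field; rewrite !gt_eqF.
  rewrite -subr_ge0.
  have -> : e / 2 + L ^+ 2 * `|t| ^+ 2 / (2 * e) - L * `|t| =
            (e - L * `|t|) ^+ 2 / (2 * e) by field; rewrite gt_eqF.
  by rewrite divr_ge0 ?sqr_ge0// mulr_ge0// ltW.
have bnd : e / 2 + q * (n%:R * x * (1 - x)) <= e.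
  have -> : q * (n%:R * x * (1 - x)) = L ^+ 2 * (x * (1 - x)) / (2 * e * n%:R).
    by rewrite /q; field; rewrite !gt_eqF.
  suff : L ^+ 2 * (x * (1 - x)) / (2 * e * n%:R) <= e / 2 by lra.
  rewrite ler_pdivrMr ?mulr_gt0//.
  have -> : e / 2 * (2 * e * n%:R) = n%:R * e ^+ 2 by field.
  have x4 : x * (1 - x) <= 2^-1 by nra.
  have := ler_wpM2l (sqr_ge0 L) x4; lra.
set b := (bernstein _ _).[x].
have ub : b <= g x + e.
  apply: (@le_trans _ _ ((bernstein n
    (fun k => (g x + e / 2) + q * (k%:R - n%:R * x) ^+ 2)).[x])).
    by apply: bernstein_le => // k /amgm; rewrite ler_norml => /andP[]; lra.
  by rewrite bernstein_quadratic subrr expr0n /= addr0; lra.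
have lb : g x - e <= b.
  apply: (@le_trans _ _ ((bernstein n
      (fun k => (g x - e / 2) + (- q) * (k%:R - n%:R * x) ^+ 2)).[x])).
    by rewrite bernstein_quadratic subrr expr0n /= addr0; lra.
  by apply: bernstein_le => // k /amgm; rewrite ler_norml => /andP[]; lra.
by rewrite ler_norml; apply/andP; split; lra.
Qed.

End Weierstrass.

(** * Exponentials are dense among decaying functions *)

Section Jets.
Variable R : realType.
Implicit Types (F G : nat -> R -> R) (B : R) (N n : nat).

Lemma is_derive1_continuous (f : R -> R) (x d : R) :
  is_derive x 1 f d -> {for x, continuous f}.
Proof.
by case=> fx _; apply: differentiable_continuous; exact/derivable1_diffP.
Qed.

Lemma is_derive1Ml (f : R -> R) (s x d : R) :
  is_derive x 1 f d -> is_derive x 1 (fun t => s * f t) (s * d).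
Proof. by move=> fd; exact: (@is_deriveZ R R R f s x 1 d fd). Qed.

Lemma is_derive1D (f g : R -> R) (x d d' : R) :
  is_derive x 1 f d -> is_derive x 1 g d' ->
  is_derive x 1 (fun t => f t + g t) (d + d').
Proof. by move=> fd gd; exact: (@is_deriveD R R R f g x 1 d d' fd gd). Qed.

Lemma is_derive_expZ (c x : R) :
  is_derive x 1 (fun t => expR (c * t)) (c * expR (c * x)).
Proof.
rewrite mulrC; apply: (@is_derive1_comp _ expR (fun t => c * t)).
by have := is_derive1Ml c (is_derive_id x (1 : R)); rewrite mulr1.
Qed.

(** Mean value theorem for the two functions [g + f] and [g - f], both nonincreasing from [x] on. *)
Lemma le_of_derive_le (f g df dg : R -> R) (x y : R) :
  (forall t : R, is_derive t 1 f (df t)) -> (forall t : R, is_derive t 1 g (dg t)) ->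
  (forall t, x <= t -> `|df t| <= - dg t) -> x <= y ->
  `|f y - f x| <= g x - g y.
Proof.
move=> Df Dg le_d xy.
have mono (s : R) : s = 1 \/ s = -1 -> s * f x + g x >= s * f y + g y.
  move=> s1; have Dh (t : R) : is_derive t 1 (fun t => s * f t + g t) (s * df t + dg t).
    exact: is_derive1D (is_derive1Ml s (Df t)) (Dg t).
  have [|c cxy E] := MVT_segment xy (fun t _ => Dh t).
    apply: continuous_subspaceT => t; exact: is_derive1_continuous (Dh t).
  rewrite -subr_le0 E.
  rewrite mulr_le0_ge0 ?subr_ge0//.
  move: cxy; rewrite in_itv/= => /andP[xc _]; have := le_d _ xc.
  by rewrite ler_norml => /andP[]; case: s1 => ->; lra.
have h1 := mono 1 (or_introl erefl); have h2 := mono (-1) (or_intror erefl).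
rewrite ler_norml; apply/andP; split; lra.
Qed.

Lemma expR_small (c B e : R) (x : R) : 0 < c -> 0 < e ->
  exists2 y, x <= y & 0 <= y /\ B * expR (- (c * y)) <= e.
Proof.
move=> c0 e0; pose y := Num.max (Num.max 0 x) (`|B| / (e * c)).
have y0 : 0 <= y by rewrite !le_max lexx.
exists y; first by rewrite !le_max lexx orbT.
split=> //; apply: (@le_trans _ _ (`|B| * expR (- (c * y)))).
  by rewrite ler_wpM2r ?expR_ge0 ?ler_norm.
rewrite expRN ler_pdivrMr ?expR_gt0//.
have yB : `|B| / (e * c) <= y by rewrite !le_max lexx orbT.
move: yB; rewrite ler_pdivrMr ?mulr_gt0// => yB.
apply: (le_trans yB); rewrite mulrC -mulrA ler_wpM2l ?ltW//.
have := expR_ge1Dx (c * y); lra.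
Qed.

(** In effect [u x] is minus the integral of [du] over [x, +oo[. The bound with [B'] makes [u y]
    negligible at a remote [y], so [B'] disappears from the resulting constant. *)
Lemma decay_antiderivative (u du : R -> R) (c B B' : R) : 0 < c ->
  (forall x : R, is_derive x 1 u (du x)) ->
  (forall x, 0 <= x -> `|du x| <= B * expR (- (c * x))) ->
  (forall x, 0 <= x -> `|u x| <= B' * expR (- (c * x))) ->
  forall x, 0 <= x -> `|u x| <= B / c * expR (- (c * x)).
Proof.
move=> c0 Du duB uB x x0; apply/ler_addgt0Pr => e e0.
have e2 : 0 < e / 2 by rewrite divr_gt0.
have [y xy [y0 ye]] := expR_small (B' + `|B| / c) x c0 e0.
have := @le_of_derive_le u (fun t => (B / c) * expR ((- c) * t)) du
  (fun t => (B / c) * ((- c) * expR ((- c) * t))) x y Du.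
have Dg (t : R) : is_derive t 1 (fun t => (B / c) * expR ((- c) * t))
    ((B / c) * ((- c) * expR ((- c) * t))).
  by apply: is_derive1Ml; exact: is_derive_expZ.
move=> /(_ Dg) H.
have {H} : `|u y - u x| <= B / c * expR (- c * x) - B / c * expR (- c * y).
  apply: H => // t xt; have := duB _ (le_trans x0 xt).
  by congr (_ <= _); rewrite -mulNr; field; rewrite gt_eqF.
have := uB _ y0; rewrite -!mulNr in ye *.
have := ler_distD 0 (u x) (u y).
move: ye; rewrite mulrDl.
have hB : - (B / c) * expR (- c * y) <= `|B| / c * expR (- c * y).
  rewrite ler_wpM2r ?expR_ge0// -mulNr ler_wpM2r ?invr_ge0 ?(ltW c0)//.
  by rewrite -normrN ler_norm.
have := ler_normB (u y) (u y - u x); rewrite subKr.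
by move=> *; lra.
Qed.

(** A function together with all its derivatives: linear combinations and exponentials then come
    with explicit derivatives of every order. *)
Definition jet F := forall i (x : R), is_derive x 1 (F i) (F i.+1 x).

(* Four derivatives: [sin_trans_le] integrates by parts twice, two orders at a
   time. *)
Definition exp_bounded N B F := forall i x, (i <= 4)%N -> 0 <= x ->
  `|F i x| <= B * expR (- (2 * N%:R * x)).

Definition exp_jet n : nat -> R -> R :=
  fun i x => (- (2 * n%:R)) ^+ i * expR (- (2 * n%:R * x)).

Lemma jet_exp n : jet (exp_jet n).
Proof.
move=> i x; rewrite /exp_jet.
have -> : (fun t => (- (2 * n%:R)) ^+ i * expR (- (2 * n%:R * t))) =
    (fun t => (- (2 * n%:R)) ^+ i * expR (- (2 * n%:R) * t)) :> (R -> R).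
  by apply/funext => t; rewrite mulNr.
rewrite exprSr -mulrA -(mulNr (2 * n%:R) x).
by apply: is_derive1Ml; exact: is_derive_expZ.
Qed.

Lemma exp_bounded_exp N n : (N <= n)%N ->
  exists B, exp_bounded N B (exp_jet n).
Proof.
move=> Nn; exists ((1 + 2 * n%:R) ^+ 4) => i x i4 x0.
rewrite /exp_jet normrM normrX normrN (ger0_norm (expR_ge0 _)).
rewrite ger0_norm ?mulr_ge0//.
have n0 : (0 : R) <= 2 * n%:R by rewrite mulr_ge0.
apply: ler_pM; rewrite ?exprn_ge0 ?expR_ge0//.
  apply: (@le_trans _ _ ((1 + 2 * n%:R) ^+ i)).
    by rewrite lerXn2r// ?nnegrE// ?addr_ge0// lerDr.
  by rewrite ler_weXn2l// lerDl.
by rewrite ler_expR lerN2 ler_wpM2r// ler_wpM2l// ler_nat.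
Qed.

Lemma jetD F G (a : R) : jet F -> jet G -> jet (fun i x => F i x + a * G i x).
Proof. by move=> jF jG i x; exact: is_derive1D (jF i x) (is_derive1Ml a (jG i x)). Qed.

Lemma exp_boundedD N F G (a B B' : R) :
  exp_bounded N B F -> exp_bounded N B' G ->
  exp_bounded N (B + `|a| * B') (fun i x => F i x + a * G i x).
Proof.
move=> bF bG i x i4 x0; rewrite (le_trans (ler_normD _ _))// mulrDl lerD ?bF//.
by rewrite normrM -[leRHS]mulrA ler_wpM2l// bG.
Qed.

(** The domain [P] is a parameter because the spectral functional is controlled only where the
    transform is measurable. Quantifying over all admissible [B] replaces a weighted norm. *)
Definition bounded_functional (P : (nat -> R -> R) -> Prop) N
    (T : (nat -> R -> R) -> R) :=
  (exists2 C, 0 <= C &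
     forall F B, P F -> jet F -> exp_bounded N B F -> `|T F| <= C * B) /\
  (forall F G a B B', P F -> P G -> jet F -> jet G -> exp_bounded N B F ->
     exp_bounded N B' G ->
     T (fun i x => F i x + a * G i x) = T F + a * T G).

Definition exp_poly_jet N (c : nat -> R) n : nat -> R -> R :=
  fun i x => \sum_(k < n) c k * exp_jet (N + k) i x.

Lemma exp_poly_jetS N c n : exp_poly_jet N c n.+1 =
  (fun i x => exp_poly_jet N c n i x + c n * exp_jet (N + n) i x).
Proof. by apply/funext => i; apply/funext => x; rewrite /exp_poly_jet big_ord_recr. Qed.

Lemma exp_poly_jetP N c n : jet (exp_poly_jet N c n) /\
  exists B, exp_bounded N B (exp_poly_jet N c n).
Proof.
elim: n => [|n [IHj [B IHb]]].
  have -> : exp_poly_jet N c 0 = fun _ _ => 0.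
    by apply/funext => i; apply/funext => x; rewrite /exp_poly_jet big_ord0.
  split; first by move=> i x; exact: is_derive_cst.
  by exists 0 => i x _ _; rewrite normr0 mul0r.
rewrite exp_poly_jetS; split; first by apply: jetD => //; exact: jet_exp.
have [B' bB'] := @exp_bounded_exp N (N + n) (leq_addr _ _).
by exists (B + `|c n| * B'); exact: exp_boundedD.
Qed.

Section ExpPoly.
Variables (P : (nat -> R -> R) -> Prop) (N : nat).
Hypotheses (Pexp : forall k, (N <= k)%N -> P (exp_jet k))
  (PD : forall F G a, P F -> P G -> P (fun i x => F i x + a * G i x)).

Lemma exp_poly_jet_closed c n : P (exp_poly_jet N c n).
Proof.
elim: n => [|n IH]; last by rewrite exp_poly_jetS; apply: PD => //; exact/Pexp/leq_addr.
(* Zero is reached as the difference of an exponential with itself, as [P] is only known to be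
   closed under [F + a * G]. *)
have := PD (- 1) (Pexp (leqnn N)) (Pexp (leqnn N)); congr P.
apply/funext => i; apply/funext => x.
by rewrite mulN1r subrr /exp_poly_jet big_ord0.
Qed.

Lemma bounded_functional_exp_poly T c n : bounded_functional P N T ->
  (forall k, (N <= k)%N -> T (exp_jet k) = 0) -> T (exp_poly_jet N c n) = 0.
Proof.
move=> [[C C0 TC] Tlin] T0; elim: n => [|n IH].
  (* The bound with constant 0 gives the value 0 at the zero function. *)
  have : exp_bounded N 0 (exp_poly_jet N c 0).
    by move=> i x _ _; rewrite /exp_poly_jet big_ord0 normr0 mul0r.
  move=> /(TC _ _ (exp_poly_jet_closed c 0) (exp_poly_jetP N c 0).1).
  by rewrite mulr0 normr_le0 => /eqP.
have [jF [B bF]] := exp_poly_jetP N c n.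
have [B' bB'] := @exp_bounded_exp N (N + n) (leq_addr _ _).
rewrite exp_poly_jetS.
rewrite (Tlin _ _ _ _ _ (exp_poly_jet_closed c n) _ jF (jet_exp _) bF bB').
  by rewrite IH T0 ?leq_addr// mulr0 addr0.
exact/Pexp/leq_addr.
Qed.

End ExpPoly.

(** On the compact part the maximum of [|g x exp (c x)|] serves as [B]; beyond [a] there is nothing
    to bound. *)
Lemma continuous_exp_bounded (g : R -> R) (a c : R) : continuous g ->
  (forall x, a <= x -> g x = 0) ->
  exists2 B, 0 <= B & forall x, 0 <= x -> `|g x| <= B * expR (- (c * x)).
Proof.
move=> cg g0.
have ch : continuous (fun x => `|g x * expR (c * x)|).
  move=> x; apply: (@continuous_comp _ _ _ (fun x => g x * expR (c * x))
    (fun y : R => `|y|));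
    last exact: norm_continuous.
  apply: continuousM; first exact: cg.
  exact: is_derive1_continuous (is_derive_expZ c x).
have [m _ mmax] := @EVT_max R (fun x => `|g x * expR (c * x)|) 0 (Num.max 0 a)
  (ltac:(by rewrite le_max lexx)) (continuous_subspaceT ch).
exists `|g m * expR (c * m)| => // x x0.
have [xa|ax] := leP x a; last first.
  by rewrite (g0 _ (ltW ax)) normr0 mulr_ge0 ?expR_ge0.
rewrite expRN ler_pdivlMr ?expR_gt0//.
rewrite -[X in _ * X]ger0_norm ?expR_ge0// -normrM; apply: mmax.
by rewrite in_itv/= x0 le_max xa orbT.
Qed.

Lemma jet_exp_bounded N F (a : R) : jet F ->
  (forall i x, a <= x -> F i x = 0) -> exists B, exp_bounded N B F.
Proof.
move=> jF F0.
have /choice[B] : forall i, exists B, 0 <= B /\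
    forall x, 0 <= x -> `|F i x| <= B * expR (- (2 * N%:R * x)).
  move=> i; have [] := @continuous_exp_bounded (F i) a (2 * N%:R) _ (F0 i).
    by move=> x; exact: is_derive1_continuous (jF i x).
  by move=> B; exists B.
move=> HB; exists (\sum_(i < 5) B i) => i x i4 x0.
apply: (le_trans ((HB i).2 _ x0)); rewrite ler_wpM2r ?expR_ge0//.
rewrite (bigD1 (Ordinal (i4 : (i < 5)%N)))//= lerDl sumr_ge0// => j _.
by have [] := HB j.
Qed.

Section Density.
Variables (F : nat -> R -> R) (N : nat) (a : R).
Hypotheses (jF : jet F) (F0 : forall i x, a <= x -> F i x = 0).
Hypothesis N0 : (0 < N)%N.

(** [F 4] with the weight [exp (- 2 N t)] divided out: uniform approximation of [w] is weighted
    approximation of [F 4]. *)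
Let w (t : R) : R := F 4 t * expR (2 * N%:R * t).

Let dw (t : R) : R := (F 5 t + 2 * N%:R * F 4 t) * expR (2 * N%:R * t).

Let Dw (t : R) : is_derive t 1 w (dw t).
Proof.
have := @is_deriveM R R (F 4) _ t 1 _ _ (jF 4 t) (is_derive_expZ (2 * N%:R) t).
by rewrite /GRing.scale/= /dw; congr is_derive; ring.
Qed.

(* [w] as a function of [y = expR (- 2 t)]. *)
Let g (y : R) : R := if 0 < y then w (- (ln y / 2)) else 0.

Let gexp (t : R) : g (expR (- (2 * t))) = w t.
Proof. by rewrite /g expR_gt0 expRK; congr w; field. Qed.

(** The derivative of [w] vanishes for large [t], so a multiple of the derivative of [exp (- 2 t)]
    dominates it. The second bound is the Lipschitz condition against [y = 0], the image of
    infinity. *)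
Let w_lipschitz : exists L, forall s t, 0 <= s -> 0 <= t ->
  `|w s - w t| <= L * `|expR (- (2 * s)) - expR (- (2 * t))| /\
  `|w t| <= L * expR (- (2 * t)).
Proof.
have [|B B0 HB] := @continuous_exp_bounded w a 2 (fun t => is_derive1_continuous (Dw t)).
  by move=> t ta; rewrite /w F0// mul0r.
have cdw : continuous dw.
  move=> t; apply: is_derive1_continuous.
  apply: (@is_deriveM _ _ (fun t => F 5 t + 2 * N%:R * F 4 t)).
  exact: is_derive1D (jF 5 t) (is_derive1Ml _ (jF 4 t)).
have [|B' B'0 HB'] := @continuous_exp_bounded dw a 2 cdw.
  by move=> t ta; rewrite /dw !F0// mulr0 addr0 mul0r.
exists (B + B') => s t s0 t0; split; last first.
  by apply: (le_trans (HB _ t0)); rewrite ler_wpM2r ?expR_ge0// lerDl.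
wlog st : s t s0 t0 / s <= t => [hw|].
  by have [/hw|/ltW /hw] := leP s t; [exact|rewrite distrC [X in _ * X]distrC; exact].
have Dg (x : R) : is_derive x 1 (fun t => (B + B') * expR (- 2 * t))
    ((B + B') * (- 2 * expR (- 2 * x))).
  by apply: is_derive1Ml; exact: is_derive_expZ.
have := le_of_derive_le Dw Dg _ st.
have E : `|expR (- (2 * s)) - expR (- (2 * t))| =
    expR (- (2 * s)) - expR (- (2 * t)).
  by rewrite ger0_norm// subr_ge0 ler_expR lerN2 ler_wpM2l.
rewrite distrC -mulrBr !mulNr E.
apply=> x sx; apply: (le_trans (HB' _ (le_trans s0 sx))).
rewrite (mulNr 2 x); have Ex := expR_ge0 (- (2 * x)).
by have := mulr_ge0 B0 Ex; have := mulr_ge0 B'0 Ex; lra.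
Qed.

Let approx (e : R) : 0 < e -> exists c n, forall t, 0 <= t ->
  `|F 4 t - exp_poly_jet N c n 4 t| <= e * expR (- (2 * N%:R * t)).
Proof.
move=> e0; have [L HL] := w_lipschitz.
have L0 : 0 <= L.
  have [_] := HL 0 0 (lexx _) (lexx _); rewrite mulr0 oppr0 expR0 mulr1.
  exact: le_trans.
have tE (y : R) : 0 < y <= 1 -> exists2 t, 0 <= t & y = expR (- (2 * t)).
  move=> /andP[y0 y1]; exists (- (ln y / 2)).
    by rewrite oppr_ge0 ler_pdivrMr// mul0r ln_le0.
  rewrite (_ : - (2 * _) = ln y) ?lnK//; by field.
have gL x y : 0 <= x <= 1 -> 0 <= y <= 1 -> `|g x - g y| <= L * `|x - y|.
  move=> /andP[]; rewrite le_eqVlt => /predU1P[<- _|x0 x1].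
    move=> /andP[]; rewrite le_eqVlt => /predU1P[<- _|y0 y1].
      by rewrite !subrr normr0 mulr0.
    rewrite {1}/g ltxx !sub0r !normrN.
    have [|t t0 ->] := tE y; first by rewrite y0.
    by rewrite gexp [X in _ * X]ger0_norm ?expR_ge0//; have [] := HL t t t0 t0.
  have [|s s0 ->] := tE x; first by rewrite x0.
  move=> /andP[]; rewrite le_eqVlt => /predU1P[<- _|y0 y1].
    rewrite [X in _ - X]/g ltxx !subr0.
    by rewrite gexp [X in _ * X]ger0_norm ?expR_ge0//; have [] := HL s s s0 s0.
  have [|t t0 ->] := tE y; first by rewrite y0.
  by rewrite !gexp; have [] := HL s t s0 t0.
have [p pg] := bernstein_approx e0 gL.
(* [y ^ k exp (- 2 N t)] is [exp (- 2 (N + k) t)]; dividing by [(2 (N + k)) ^ 4], nonzero as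
   [N > 0], undoes four differentiations. *)
exists (fun k => p`_k / (2 * (N + k)%:R) ^+ 4), (size p) => t t0.
have -> : exp_poly_jet N (fun k => p`_k / (2 * (N + k)%:R) ^+ 4) (size p) 4 t =
    p.[expR (- (2 * t))] * expR (- (2 * N%:R * t)).
  rewrite horner_coef mulr_suml; apply: eq_bigr => k _.
  rewrite /exp_jet -expRM_natl -(mulrA _ (expR _)) -expRD.
  have -> : k%:R * - (2 * t) - 2 * N%:R * t = - (2 * (N + k)%:R * t).
    by rewrite natrD; ring.
  rewrite mulrA; congr (_ * _); field.
  by rewrite -natrD pnatr_eq0 addn_eq0 negb_and -lt0n N0.
have -> : F 4 t = g (expR (- (2 * t))) * expR (- (2 * N%:R * t)).
  by rewrite gexp /w -mulrA -expRD subrr expR0 mulr1.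
rewrite -mulrBl normrM (ger0_norm (expR_ge0 _)) ler_wpM2r ?expR_ge0// pg//.
by rewrite expR_ge0 -[leRHS]expR0 ler_expR oppr_le0 mulr_ge0.
Qed.

(* Approximating the fourth derivative suffices: [decay_antiderivative] carries
   the weighted bound down to the lower ones. *)
Lemma exp_poly_approx (e : R) : 0 < e -> exists c n,
  exp_bounded N e (fun i x => F i x + - 1 * exp_poly_jet N c n i x).
Proof.
move=> e0; have [c [n cn]] := approx e0; exists c, n.
have [jP [B' bP]] := exp_poly_jetP N c n.
have [B bF] := jet_exp_bounded N jF F0.
set D := (fun i x => _).
have jD : jet D by exact: jetD.
have bD : exp_bounded N (B + `|- 1| * B') D by exact: exp_boundedD.
have N2 : (1 : R) <= 2 * N%:R.
  by have : (1 : R) <= N%:R by [rewrite ler1n]; lra.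
(* Descent from order 4 to order 0. Each antiderivative brings a factor [1 / (2 N) <= 1], so the
   same [e] is kept throughout. *)
have H j x : (j <= 4)%N -> 0 <= x -> `|D (4 - j)%N x| <= e * expR (- (2 * N%:R * x)).
  elim: j x => [|j IH] x j4 x0.
    by rewrite subn0 /D mulN1r cn.
  have E : (4 - j)%N = (4 - j.+1).+1 by rewrite -subSn// subSS.
  have := @decay_antiderivative (D (4 - j.+1)%N) (D (4 - j)%N) (2 * N%:R) e
    (B + `|- 1| * B') _ _ _ _ x x0.
  move=> H; apply: (@le_trans _ _ (e / (2 * N%:R) * expR (- (2 * N%:R * x)))).
    apply: H.
    - by rewrite (lt_le_trans _ N2).
    - by move=> y; rewrite E; exact: jD.
    - by move=> y y0; apply: IH => //; exact: ltnW.
    - by move=> y y0; apply: bD => //; exact: leq_subr.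
  rewrite ler_wpM2r ?expR_ge0// ler_pdivrMr ?(lt_le_trans _ N2)//.
  by rewrite -[leLHS]mulr1 ler_wpM2l// ltW.
by move=> i x i4 x0; rewrite -(subKn i4); apply: H => //; exact: leq_subr.
Qed.

(** [T F] equals [T (F - p)] for every exponential polynomial [p], and boundedness makes the latter
    as small as the approximation is good. *)
Lemma bounded_functional_eq0 P T :
  (forall k, (N <= k)%N -> P (exp_jet k)) ->
  (forall G H b, P G -> P H -> P (fun i x => G i x + b * H i x)) ->
  bounded_functional P N T ->
  (forall k, (N <= k)%N -> T (exp_jet k) = 0) -> P F -> T F = 0.
Proof.
move=> Pexp PD bT T0 PF; have [[C C0 TC] Tlin] := bT.
have [B bF] := jet_exp_bounded N jF F0.
apply/eqP; rewrite -normr_le0; apply/ler_addgt0Pr => e e0; rewrite add0r.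
have C1 : 0 < C + 1 by rewrite ltr_wpDl.
(* Division by [C + 1], because [C] may be 0. *)
have [c [n cn]] := exp_poly_approx (divr_gt0 e0 C1).
have [jP [B' bP]] := exp_poly_jetP N c n.
have PP := exp_poly_jet_closed Pexp PD c n.
have := Tlin _ _ (- 1) _ _ PF PP jF jP bF bP.
rewrite (bounded_functional_exp_poly Pexp PD)// mulr0 addr0 => <-.
apply: le_trans (TC _ _ (PD _ _ (- 1) PF PP) (jetD (- 1) jF jP) cn) _.
by rewrite mulrCA ler_piMr ?(ltW e0)// ler_pdivrMr// mul1r lerDl.
Qed.

End Density.

End Jets.

(** * Integrals of exponentially decaying functions on the half-line *)

Section RealIntegrable.
Context d (T : measurableType d) (R : realType).
Variables (mu : {measure set T -> \bar R}) (D : set T).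
Hypothesis mD : measurable D.

Lemma integrableMl (h : T -> R) (a : R) : mu.-integrable D (EFin \o h) ->
  mu.-integrable D (EFin \o (fun x => a * h x)).
Proof.
by move=> /(integrableZl mD a); apply: eq_integrable => // x _ /=; rewrite EFinM.
Qed.

Lemma RintegralD_Ml (h k : T -> R) (a : R) : mu.-integrable D (EFin \o h) ->
  mu.-integrable D (EFin \o k) ->
  Rintegral mu D (fun x => h x + a * k x) = Rintegral mu D h + a * Rintegral mu D k.
Proof. by move=> ih ik; rewrite RintegralD ?RintegralZl//; exact: integrableMl. Qed.

End RealIntegrable.

Section Decaying.
Variable R : realType.
Local Notation mu := (@lebesgue_measure R).
Implicit Types (c B : R) (h H : R -> R).

Lemma is_derive_expN c (x : R) :
  is_derive x 1 (fun t => expR (- (c * t))) (- c * expR (- (c * x))).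
Proof.
have -> : (fun t => expR (- (c * t))) = (fun t : R => expR (- c * t)).
  by apply/funext => t; rewrite mulNr.
by rewrite -(mulNr c x); exact: is_derive_expZ.
Qed.

Lemma continuous_expN c : continuous (fun t : R => expR (- (c * t))).
Proof. by move=> x; exact: is_derive1_continuous (is_derive_expN c x). Qed.

Lemma expR_cvgNy c : 0 < c -> expR (- (c * x)) @[x --> +oo] --> (0 : R).
Proof.
move=> c0; apply/cvgr0Pnorm_le => e e0.
have [y _ [y0 ye]] := expR_small 1 0 c0 e0.
near=> x; have yx : y <= x by near: x; apply: nbhs_pinfty_ge; exact: num_real.
rewrite ger0_norm ?expR_ge0//; apply: le_trans ye; rewrite mul1r.
by rewrite ler_expR lerN2 ler_wpM2l ?(ltW c0).
Unshelve. all: by end_near. Qed.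

Lemma ge0_Rintegral_FTCy h H (a l : R) : (forall x, a <= x -> 0 <= h x) ->
  continuous h -> (forall x : R, is_derive x 1 H (h x)) ->
  H x @[x --> +oo] --> l ->
  mu.-integrable `[a, +oo[ (EFin \o h) /\
  Rintegral mu `[a, +oo[ h = l - H a.
Proof.
move=> h0 ch DH Hl.
have E : (\int[mu]_(x in `[a, +oo[) (h x)%:E = l%:E - (H a)%:E)%E.
  apply: ge0_continuous_FTC2y => //.
  - exact: continuous_subspaceT.
  - by apply: cvg_at_right_filter; exact: is_derive1_continuous (DH a).
  - by move=> x _; rewrite derive1E; case: (DH x).
split; last by rewrite /Rintegral E.
apply/integrableP; split.
  by apply/measurable_EFinP; apply: measurable_funTS; exact: continuous_measurable_fun.
under eq_integral.
  move=> x /set_mem /=; rewrite in_itv/= andbT => ax.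
  rewrite ger0_norm ?h0//.
  over.
by rewrite E -EFinB ltry.
Qed.

Lemma Rintegral_exp c B : 0 < c ->
  mu.-integrable `[0, +oo[ (EFin \o (fun x => B * expR (- (c * x)))) /\
  Rintegral mu `[0, +oo[ (fun x => B * expR (- (c * x))) = B / c.
Proof.
move=> c0; have D1 (x : R) : is_derive x 1 (fun t => (- c^-1) * expR (- (c * t)))
    (expR (- (c * x))).
  have := is_derive1Ml (- c^-1) (is_derive_expN c x).
  by rewrite mulrA mulrNN mulVf ?gt_eqF// mul1r.
have [||i0 E] := @ge0_Rintegral_FTCy (fun x => expR (- (c * x)))
    (fun t => (- c^-1) * expR (- (c * t))) 0 0 (fun _ _ => expR_ge0 _) _ D1.
- exact: continuous_expN.
- by rewrite -[X in _ --> X](mulr0 (- c^-1)); apply: cvgMr; exact: expR_cvgNy.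
split.
  exact: integrableMl.
by rewrite RintegralZl// E mulr0 oppr0 expR0 mulr1 sub0r opprK.
Qed.

Lemma exp_le_integrable h c B : 0 < c -> measurable_fun (`[0, +oo[ : set R) h ->
  (forall x, 0 <= x -> `|h x| <= B * expR (- (c * x))) ->
  mu.-integrable `[0, +oo[ (EFin \o h) /\
  `|Rintegral mu `[0, +oo[ h| <= B / c.
Proof.
move=> c0 mh hB; have [iB EB] := Rintegral_exp B c0.
have ih : mu.-integrable `[0, +oo[ (EFin \o h).
  apply: le_integrable iB => //; first exact/measurable_EFinP.
  move=> x /=; rewrite in_itv/= andbT => x0; rewrite lee_fin.
  by apply: (le_trans (hB _ x0)); rewrite ler_norm.
split=> //; rewrite -EB; apply: le_trans (le_normr_Rintegral _ ih) _ => //.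
apply: le_Rintegral => //; first exact: integrable_norm ih.
by move=> x /=; rewrite in_itv/= andbT => x0; exact: hB.
Qed.

(* Adding the majorant makes the integrand nonnegative. *)
Lemma Rintegral_exp_FTC h H c B B' : 0 < c -> continuous h ->
  (forall x : R, is_derive x 1 H (h x)) ->
  (forall x, 0 <= x -> `|h x| <= B * expR (- (c * x))) ->
  (forall x, 0 <= x -> `|H x| <= B' * expR (- (c * x))) ->
  Rintegral mu `[0, +oo[ h = - H 0.
Proof.
move=> c0 ch DH hB HB.
have mh : measurable_fun (`[0, +oo[ : set R) h.
  by apply: measurable_funTS; exact: continuous_measurable_fun.
have [ih _] := exp_le_integrable c0 mh hB.
have [ie Ee] := Rintegral_exp B c0.
have DE (x : R) : is_derive x 1 (fun t => B * (- c^-1 * expR (- (c * t))))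
    (B * expR (- (c * x))).
  have := is_derive1Ml B (is_derive1Ml (- c^-1) (is_derive_expN c x)).
  by congr is_derive; field; rewrite gt_eqF.
have ce : continuous (fun x => B * expR (- (c * x))).
  by move=> x; exact: is_derive1_continuous (is_derive1Ml B (is_derive_expN c x)).
have [|||_ E] := @ge0_Rintegral_FTCy (fun x => h x + B * expR (- (c * x)))
    (fun t => H t + B * (- c^-1 * expR (- (c * t)))) 0 0 _ _
    (fun x => is_derive1D (DH x) (DE x)).
- by move=> x /hB; rewrite ler_norml => /andP[]; lra.
- move=> x; apply: (@continuousD _ _ _ h (fun x => B * expR (- (c * x)))).
    exact: ch.
  exact: ce.
- rewrite -[X in _ --> X]addr0; apply: cvgD; last first.
    rewrite -[X in _ --> X](mulr0 B); apply: cvgMr.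
    rewrite -[X in _ --> X](mulr0 (- c^-1)); apply: cvgMr.
    exact: expR_cvgNy.
  apply/norm_cvg0P; apply: (@squeeze_cvgr _ _ _ _ (cst 0) (fun x => B' * expR (- (c * x)))).
  + by near=> x; rewrite normr_ge0/=; apply: HB; near: x; apply: nbhs_pinfty_ge; exact: num_real.
  + exact: cvg_cst.
  + by rewrite -[X in _ --> X](mulr0 B'); apply: cvgMr; exact: expR_cvgNy.
move: E; rewrite RintegralD// Ee mulr0 oppr0 expR0 => E.
have : Rintegral mu `[0, +oo[ h = 0 - (H 0 + B * (- c^-1 * 1)) - B / c.
  by rewrite -E addrK.
by move=> ->; ring.
Unshelve. all: by end_near. Qed.

End Decaying.

(** * Transforms against the kernel sin (2 x sqrt l) / sqrt l *)

Section SinKernel.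
Variable R : realType.
Local Notation mu := (@lebesgue_measure R).
Implicit Types (F : nat -> R -> R) (B K l x : R) (N : nat).

(** The [x]-derivative of [sin_kernel x l]: [2 cos (2 x sqrt l)], continued to [l <= 0] as
    [2 cosh (2 x sqrt (- l))]. *)
Definition cos_kernel x l : R :=
  if 0 < l then 2 * cos (2 * x * Num.sqrt l)
  else if l == 0 then 2
  else let s := Num.sqrt (- l) in expR (2 * x * s) + expR (- (2 * x * s)).

Lemma is_derive_linear (c x : R) : is_derive x 1 (fun t : R => 2 * t * c) (2 * c).
Proof.
have -> : (fun t : R => 2 * t * c) = (fun t : R => (2 * c) * t).
  by apply/funext => t; ring.
by have := is_derive1Ml (2 * c) (is_derive_id x (1 : R)); rewrite mulr1.
Qed.

Lemma is_derive_expNr (c x : R) :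
  is_derive x 1 (fun t : R => expR (- (2 * t * c))) (- (2 * c) * expR (- (2 * x * c))).
Proof.
have -> : (fun t : R => expR (- (2 * t * c))) = (fun t : R => expR (- (2 * c) * t)).
  by apply/funext => t; congr expR; ring.
have -> : - (2 * x * c) = - (2 * c) * x by ring.
exact: is_derive_expZ.
Qed.

Lemma is_derive_expP (c x : R) :
  is_derive x 1 (fun t : R => expR (2 * t * c)) ((2 * c) * expR (2 * x * c)).
Proof.
have -> : (fun t : R => expR (2 * t * c)) = (fun t : R => expR ((2 * c) * t)).
  by apply/funext => t; congr expR; ring.
have -> : 2 * x * c = 2 * c * x by ring.
exact: is_derive_expZ.
Qed.

Lemma is_derive_sin_kernel l x :
  is_derive x 1 (fun t => sin_kernel t l) (cos_kernel x l).
Proof.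
rewrite /sin_kernel /cos_kernel; case: (ltrgtP l 0) => [l0|l0|_] /=.
- set s := Num.sqrt (- l).
  have s0 : 0 < s by rewrite sqrtr_gt0 oppr_gt0.
  have := is_derive1Ml (2^-1 / s) (is_derive1D (is_derive_expP s x)
    (is_derive1Ml (- 1) (is_derive_expNr s x))).
  congr is_derive; first by apply/funext => t /=; rewrite mulN1r; field; rewrite gt_eqF.
  by field; rewrite gt_eqF.
- have s0 : 0 < Num.sqrt l by rewrite sqrtr_gt0.
  have := is_derive1Ml (Num.sqrt l)^-1
    (@is_derive1_comp _ sin (fun t => 2 * t * Num.sqrt l) _ _ _ (is_derive_sin _)
      (is_derive_linear (Num.sqrt l) x)).
  congr is_derive; first by apply/funext => t /=; rewrite mulrC.
  by field; rewrite gt_eqF.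
- by have := is_derive_linear 1 x; under eq_fun do rewrite mulr1; rewrite mulr1.
Qed.

Lemma is_derive_cos_kernel l x :
  is_derive x 1 (fun t => cos_kernel t l) (- (4 * l) * sin_kernel x l).
Proof.
rewrite /sin_kernel /cos_kernel; case: (ltrgtP l 0) => [l0|l0|->] /=.
- set s := Num.sqrt (- l).
  have s0 : 0 < s by rewrite sqrtr_gt0 oppr_gt0.
  have s2 : l = - s ^+ 2 by rewrite sqr_sqrtr ?opprK// oppr_ge0 ltW.
  have := is_derive1D (is_derive_expP s x) (is_derive_expNr s x).
  by congr is_derive; rewrite [in RHS]s2; field; rewrite gt_eqF.
- set s := Num.sqrt l; have s0 : 0 < s by rewrite sqrtr_gt0.
  have s2 : l = s ^+ 2 by rewrite sqr_sqrtr// ltW.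
  have := is_derive1Ml 2
    (@is_derive1_comp _ cos (fun t => 2 * t * s) _ _ _ (is_derive_cos _) (is_derive_linear s x)).
  by congr is_derive; rewrite [in RHS]s2; field; rewrite gt_eqF.
- by rewrite mulr0 oppr0 mul0r; exact: is_derive_cst.
Qed.

Lemma sin_kernel0 l : sin_kernel 0 l = 0.
Proof.
rewrite /sin_kernel !mulr0 !mul0r sin0 oppr0 expR0 subrr !mul0r.
by case: ifP => //; case: ifP.
Qed.

Lemma cos_kernel0 l : cos_kernel 0 l = 2.
Proof.
rewrite /cos_kernel !mulr0 !mul0r cos0 oppr0 expR0 mulr1.
by case: ifP => //; case: ifP => //; rewrite -mulr2n.
Qed.

Lemma sin_kernelN l x : sin_kernel (- x) l = - sin_kernel x l.
Proof.
rewrite /sin_kernel !mulrN !mulNr sinN mulNr opprK /=.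
by case: ifP => // _; case: ifP => // _; rewrite -!mulNr opprB.
Qed.

(** The lower bound on the spectrum enters here: for negative [l] the growth rate [sqrt (- l)] is at
    most [K]. *)
Lemma cos_kernel_le K l x : 0 <= K -> - K ^+ 2 <= l -> 0 <= x ->
  `|cos_kernel x l| <= 2 * expR (2 * K * x).
Proof.
move=> K0 Kl x0.
have e1 : 1 <= expR (2 * K * x).
  by rewrite -expR0 ler_expR !mulr_ge0.
rewrite /cos_kernel; case: (ltrgtP l 0) => [l0|l0|_] /=; last first.
- by rewrite ger0_norm//; lra.
- have := cos_max (2 * x * Num.sqrt l).
  by rewrite normrM ger0_norm//; lra.
- set s := Num.sqrt (- l).
  have s0 : 0 <= s by rewrite sqrtr_ge0.
  have sK : s <= K.
    by rewrite -[leRHS](ger0_norm K0) -sqrtr_sqr ler_wsqrtr// lerNl.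
  rewrite ger0_norm ?addr_ge0 ?expR_ge0//.
  have h1 : expR (2 * x * s) <= expR (2 * K * x).
    by rewrite ler_expR -!mulrA ler_wpM2l// mulrC ler_wpM2r.
  have h2 : expR (- (2 * x * s)) <= 1.
    by rewrite -expR0 ler_expR oppr_le0 !mulr_ge0.
  lra.
Qed.

(** Integrates the bound on [cos_kernel] from 0. The rate [K + 1] makes the derivative of the
    majorant at least [2 exp (2 K x)] even for [K = 0]. *)
Lemma sin_kernel_le K l x : 0 <= K -> - K ^+ 2 <= l -> 0 <= x ->
  `|sin_kernel x l| <= expR (2 * (K + 1) * x).
Proof.
move=> K0 Kl x0.
have Dg (t : R) : is_derive t 1 (fun t => -1 * expR ((2 * (K + 1)) * t))
    (-1 * ((2 * (K + 1)) * expR ((2 * (K + 1)) * t))).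
  exact: is_derive1Ml (is_derive_expZ _ _).
have := le_of_derive_le (is_derive_sin_kernel l) Dg _ x0.
rewrite sin_kernel0 subr0 mulr0 expR0 => H.
apply: (@le_trans _ _ (expR (2 * (K + 1) * x) - 1)); last by rewrite lerBlDr lerDl.
have -> : expR (2 * (K + 1) * x) - 1 = -1 * 1 - -1 * expR (2 * (K + 1) * x) by ring.
apply: H => t t0; apply: (le_trans (cos_kernel_le K0 Kl t0)).
rewrite mulN1r opprK ler_pM ?expR_ge0//; first by lra.
by rewrite ler_expR ler_wpM2r//; lra.
Qed.

Section Transform.
Variables (K : R) (N : nat).
Hypotheses (K0 : 0 <= K) (KN : K + 2 <= N%:R).

Definition sin_integral F i l : R :=
  Rintegral mu `[0, +oo[ (fun x => F i x * sin_kernel x l).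

(** The margin in [K + 2 <= N]: one unit pays for the rate [K + 1] of the kernel, the other leaves
    the decay [exp (- 2 x)]. *)
Let exp_mul (x : R) : 0 <= x ->
  expR (- (2 * N%:R * x)) * expR (2 * (K + 1) * x) <= expR (- (2 * x)).
Proof.
move=> x0; rewrite -expRD ler_expR.
have -> : - (2 * N%:R * x) + 2 * (K + 1) * x = (K + 1 - N%:R) * (2 * x) by ring.
have -> : - (2 * x) = (-1) * (2 * x) by ring.
by rewrite ler_wpM2r ?mulr_ge0//; have := KN; lra.
Qed.

Let cmul F B i l x : exp_bounded N B F -> (i <= 4)%N -> - K ^+ 2 <= l -> 0 <= x ->
  `|F i x * sin_kernel x l| <= B * expR (- (2 * x)) /\
  `|F i x * cos_kernel x l| <= 2 * B * expR (- (2 * x)).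
Proof.
move=> bF i4 Kl x0; have Fx := bF i x i4 x0.
have B0 : 0 <= B.
  have := le_trans (normr_ge0 _) (bF i 0 i4 (lexx 0)).
  by rewrite mulr0 oppr0 expR0 mulr1.
have Sx := sin_kernel_le K0 Kl x0.
have Cx : `|cos_kernel x l| <= 2 * expR (2 * (K + 1) * x).
  apply: (le_trans (cos_kernel_le K0 Kl x0)); rewrite ler_wpM2l// ler_expR.
  by rewrite ler_wpM2r//; lra.
have E := ler_wpM2l B0 (exp_mul x0).
rewrite !normrM; split.
  by apply: le_trans E; rewrite mulrA; apply: ler_pM.
rewrite -mulrA; apply: le_trans (ler_wpM2l (ler0n _ 2) E).
by rewrite [B * _]mulrA mulrCA; apply: ler_pM.
Qed.

Let cFS F i l : jet F -> continuous (fun x => F i x * sin_kernel x l).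
Proof.
move=> jF x; apply: (@continuousM _ _ (F i) (fun t => sin_kernel t l)).
  exact: is_derive1_continuous (jF i x).
exact: is_derive1_continuous (is_derive_sin_kernel l x).
Qed.

Lemma sin_integral_integrable F B i l : jet F -> exp_bounded N B F ->
  (i <= 4)%N -> - K ^+ 2 <= l ->
  mu.-integrable `[0, +oo[ (EFin \o (fun x => F i x * sin_kernel x l)) /\
  `|sin_integral F i l| <= B / 2.
Proof.
move=> jF bF i4 Kl; apply: exp_le_integrable => //.
  by apply: measurable_funTS; apply: continuous_measurable_fun; exact: cFS.
by move=> x x0; have [] := cmul bF i4 Kl x0.
Qed.

(** With [s] the sine kernel and [F] for [F i], [s'' = - 4 l s], so the combined integrand is the
    derivative of the Wronskian [F' s - F s']. This decays at infinity, and at 0 one has [s = 0] and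
    [s' = 2]. *)
Lemma sin_integral_deriv2 F B i l : jet F -> exp_bounded N B F ->
  (i <= 2)%N -> - K ^+ 2 <= l ->
  sin_integral F i.+2 l + 4 * l * sin_integral F i l = 2 * F i 0.
Proof.
move=> jF bF i2 Kl.
have i4 : (i <= 4)%N by rewrite (leq_trans i2).
have [i0 _] := sin_integral_integrable jF bF i4 Kl.
have [i1 _] := sin_integral_integrable jF bF (i2 : (i.+2 <= 4)%N) Kl.
rewrite /sin_integral -RintegralD_Ml//.
pose H (x : R) := F i.+1 x * sin_kernel x l + -1 * (F i x * cos_kernel x l).
have DH (x : R) : is_derive x 1 H (F i.+2 x * sin_kernel x l + 4 * l * (F i x * sin_kernel x l)).
  have D1 := @is_deriveM R R (F i.+1) (fun t => sin_kernel t l) x 1 _ _ (jF i.+1 x)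
    (is_derive_sin_kernel l x).
  have D2 := @is_deriveM R R (F i) (fun t => cos_kernel t l) x 1 _ _ (jF i x)
    (is_derive_cos_kernel l x).
  have := is_derive1D D1 (is_derive1Ml (-1) D2).
  by rewrite /GRing.scale/=; congr is_derive; ring.
rewrite (@Rintegral_exp_FTC _ _ H 2 (B + `|4 * l| * B) (B + 2 * B))//.
- by rewrite /H sin_kernel0 cos_kernel0; ring.
- move=> x; apply: (@continuousD _ _ _ (fun x => F i.+2 x * sin_kernel x l)
    (fun x => 4 * l * (F i x * sin_kernel x l))); first exact: cFS.
  apply: (@continuousM _ _ (cst (4 * l)) (fun x => F i x * sin_kernel x l)).
    exact: cst_continuous.
  exact: cFS.
- move=> x x0; rewrite (le_trans (ler_normD _ _))// [leRHS]mulrDl lerD//.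
    by have [] := cmul bF (i2 : (i.+2 <= 4)%N) Kl x0.
  by rewrite normrM -[leRHS]mulrA ler_wpM2l//; have [] := cmul bF i4 Kl x0.
- move=> x x0; rewrite (le_trans (ler_normD _ _))// [leRHS]mulrDl lerD//.
    by have [] := cmul bF (ltnW (i2 : (i.+2 <= 4)%N)) Kl x0.
  by rewrite mulN1r normrN; have [] := cmul bF i4 Kl x0.
Qed.

(* The subtracted term makes this [O (l ^- 2)] even when [F 0 0 != 0]. *)
Definition sin_trans F l : R :=
  2 * sin_integral F 0 l - F 0 0 * (l / (1 + l ^+ 2)).

(* With [J i := sin_integral F i l], two uses of [sin_integral_deriv2] give
   [(1 + l ^+ 2) * sin_trans F l = 2 * J 0 - F 2 0 / 4 + J 4 / 8]. *)
Lemma sin_trans_le F B l : jet F -> exp_bounded N B F -> - K ^+ 2 <= l ->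
  `|sin_trans F l| <= 2 * B / (1 + l ^+ 2).
Proof.
move=> jF bF Kl.
have l2 : 0 < 1 + l ^+ 2 by rewrite ltr_wpDr ?sqr_ge0.
have E0 := sin_integral_deriv2 jF bF (isT : (0 <= 2)%N) Kl.
have E2 := sin_integral_deriv2 jF bF (isT : (2 <= 2)%N) Kl.
have [_ J0] := sin_integral_integrable jF bF (isT : (0 <= 4)%N) Kl.
have [_ J4] := sin_integral_integrable jF bF (isT : (4 <= 4)%N) Kl.
have F2 := bF 2%N 0 isT (lexx 0); rewrite mulr0 oppr0 expR0 mulr1 in F2.
have -> : sin_trans F l = (2 * sin_integral F 0 l - F 2%N 0 / 4 + sin_integral F 4 l / 8)
    / (1 + l ^+ 2).
  apply: (mulIf (lt0r_neq0 l2)); rewrite divfK ?gt_eqF// /sin_trans mulrBl.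
  rewrite -[X in _ - X]mulrA divfK ?gt_eqF//.
  have -> : sin_integral F 4 l = 2 * F 2%N 0 - 4 * l * (2 * F 0%N 0 - 4 * l * sin_integral F 0 l).
    have E : sin_integral F 2 l = 2 * F 0%N 0 - 4 * l * sin_integral F 0 l by lra.
    by rewrite -E; lra.
  by field.
rewrite normrM normfV (gtr0_norm l2) ler_wpM2r ?invr_ge0 ?(ltW l2)//.
move: J0 J4 F2; rewrite !ler_norml => /andP[? ?] /andP[? ?] /andP[? ?].
by apply/andP; split; lra.
Qed.

Lemma sin_transD F G a B B' l : jet F -> jet G -> exp_bounded N B F ->
  exp_bounded N B' G -> - K ^+ 2 <= l ->
  sin_trans (fun i x => F i x + a * G i x) l = sin_trans F l + a * sin_trans G l.
Proof.
move=> jF jG bF bG Kl; rewrite /sin_trans.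
have [iF _] := sin_integral_integrable jF bF (isT : (0 <= 4)%N) Kl.
have [iG _] := sin_integral_integrable jG bG (isT : (0 <= 4)%N) Kl.
have -> : sin_integral (fun i x => F i x + a * G i x) 0 l =
    sin_integral F 0 l + a * sin_integral G 0 l.
  rewrite /sin_integral -RintegralD_Ml//.
  by apply: eq_Rintegral => x _; ring.
ring.
Qed.

(** Since [F'' = (2 n) ^ 2 F], the identity from two integrations by parts becomes a linear equation
    for the transform itself, whatever the sign of [l]. *)
Lemma sin_trans_exp n l : (N <= n)%N -> - K ^+ 2 <= l ->
  sin_trans (exp_jet n) l = (l + n%:R ^+ 2)^-1 - l / (1 + l ^+ 2).
Proof.
move=> Nn Kl; have [B bB] := @exp_bounded_exp R N n Nn.
have := sin_integral_deriv2 (@jet_exp R n) bB (isT : (0 <= 2)%N) Kl.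
have -> : sin_integral (exp_jet n) 2 l = (2 * n%:R) ^+ 2 * sin_integral (exp_jet n) 0 l.
  have [i0 _] := sin_integral_integrable (@jet_exp R n) bB (isT : (0 <= 4)%N) Kl.
  rewrite /sin_integral -RintegralZl//; apply: eq_Rintegral => x _.
  by rewrite /exp_jet; ring.
rewrite /sin_trans /exp_jet mulr0 oppr0 expR0 !expr0 !mulr1 mul1r -/(exp_jet n) => E.
have n2 : 0 < l + n%:R ^+ 2.
  have : K + 2 <= n%:R by rewrite (le_trans KN)// ler_nat.
  by have := K0; nra.
congr (_ - _); apply: (mulIf (lt0r_neq0 n2)); rewrite mulVf ?gt_eqF//.
by move: E; rewrite /sin_integral /exp_jet; lra.
Qed.

End Transform.

Lemma herglotz_continuous (c l : R) : 0 < l + c ->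
  {for l, continuous (fun x => (x + c)^-1 - x / (1 + x ^+ 2))}.
Proof.
move=> lc; have l2 : 0 < 1 + l ^+ 2 by rewrite ltr_wpDr ?sqr_ge0.
apply: (@continuousB _ _ _ (fun x => (x + c)^-1) (fun x => x / (1 + x ^+ 2))).
  apply: (@continuousV _ _ (fun x => x + c)); first by rewrite gt_eqF.
  by apply: (@continuousD _ _ _ id (cst c)); [exact: cvg_id|exact: cst_continuous].
apply: (@continuousM _ _ id (fun x => (1 + x ^+ 2)^-1)); first exact: cvg_id.
apply: (@continuousV _ _ (fun x => 1 + x ^+ 2)); first by rewrite gt_eqF.
by apply: (@continuousD _ _ _ (cst (1 : R)) (fun x : R => x ^+ 2));
  [exact: cst_continuous|exact: exprn_continuous].
Qed.

(* A pointwise limit of the explicit transforms of exponential polynomials. *)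
Lemma sin_trans_measurable F (a : R) : jet F ->
  (forall i x, a <= x -> F i x = 0) -> measurable_fun setT (sin_trans F).
Proof.
move=> jF F0.
have {F0 jF} H K : 0 <= K -> measurable_fun `[- K ^+ 2, +oo[ (sin_trans F).
  move=> K0; pose N := (Num.trunc (K + 2)).+1.
  have KN : K + 2 <= N%:R by apply/ltW/truncnS_gt.
  have N0 : (0 < N)%N by [].
  have /choice[c /choice[n cn]] : forall k : nat, exists c n,
      exp_bounded N k.+1%:R^-1 (fun i x => F i x + - 1 * exp_poly_jet N c n i x).
    by move=> k; apply: (exp_poly_approx jF F0 N0); rewrite invr_gt0.
  have [B bF] := jet_exp_bounded N jF F0.
  apply: (@measurable_fun_cvg _ _ _ _ (fun k => sin_trans (exp_poly_jet N (c k) (n k)))).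
    move=> k; elim: (n k) => [|m IH].
      apply: (@eq_measurable_fun _ _ R R _ (cst (0 : R))); last exact: measurable_cst.
      move=> l; rewrite inE/= in_itv/= andbT => Kl.
      have : exp_bounded N 0 (exp_poly_jet N (c k) 0).
        by move=> i x _ _; rewrite /exp_poly_jet big_ord0 normr0 mul0r.
      move=> /(sin_trans_le K0 KN (exp_poly_jetP N (c k) 0).1) /(_ Kl).
      by rewrite mulr0 mul0r normr_le0 => /eqP ->.
    have [jP [B' bP]] := exp_poly_jetP N (c k) m.
    have [B'' bE] := @exp_bounded_exp R N (N + m) (leq_addr _ _).
    apply: (@eq_measurable_fun _ _ R R _ (fun l : R => sin_trans (exp_poly_jet N (c k) m) l +
        c k m * ((l + (N + m)%:R ^+ 2)^-1 - l / (1 + l ^+ 2)))).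
      move=> l; rewrite inE/= in_itv/= andbT => Kl.
      rewrite exp_poly_jetS (sin_transD K0 KN _ jP (jet_exp _) bP bE Kl).
      by rewrite (sin_trans_exp K0 KN (leq_addr _ _) Kl).
    apply: measurable_funD => //; apply: measurable_funM; first exact: measurable_cst.
    (* Continuity yields measurability on an open set, so the half-line is enlarged by one unit; the
       pole [- (N + m) ^ 2] stays to its left. *)
    have sub : `[- K ^+ 2, +oo[ `<=` `]- K ^+ 2 - 1, +oo[.
      by move=> l /=; rewrite !in_itv/= !andbT; lra.
    apply: (measurable_funS _ sub) => //; apply: open_continuous_measurable_fun.
      exact: interval_open.
    move=> l; rewrite inE/= in_itv/= andbT => Kl.
    have n2 : 0 < l + (N + m)%:R ^+ 2.
      have : K + 2 <= (N + m)%:R by rewrite (le_trans KN)// ler_nat leq_addr.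
      by nra.
    exact: herglotz_continuous.
  move=> l; rewrite /= in_itv/= andbT => Kl; apply/cvgrPdist_le => e e0.
  near=> k.
  have [jP [B' bP]] := exp_poly_jetP N (c k) (n k).
  have := sin_trans_le K0 KN (jetD (-1) jF jP) (cn k) Kl.
  rewrite (sin_transD K0 KN _ jF jP bF bP Kl) mulN1r => /le_trans; apply.
  have l2 : 1 <= 1 + l ^+ 2 by rewrite lerDl sqr_ge0.
  rewrite ler_pdivrMr ?(lt_le_trans _ l2)//.
  apply: (@le_trans _ _ e); last by rewrite ler_peMr ?(ltW e0).
  rewrite ler_pdivrMr// -ler_pdivrMl//.
  near: k; apply: filterS (nbhs_infty_gtr (e^-1 * 2)) => k /ltW /le_trans; apply.
  by rewrite ler_nat.
(* [N] depends on [K], so measurability is glued from half-lines that exhaust the line. *)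
have -> : setT = \bigcup_k `[- (k%:R : R) ^+ 2, +oo[%classic.
  apply/seteqP; split => // l _; exists (Num.trunc `|l|).+1 => //=.
  rewrite in_itv/= andbT lerNl.
  have := truncnS_gt `|l|; set k := _%:R => lk.
  have := ler_norm (- l); rewrite normrN.
  have : (1 : R) <= k by rewrite ler1n.
  nra.
by apply/measurable_fun_bigcup => // k; exact: H.
Unshelve. all: by end_near. Qed.

End SinKernel.

(** * The spectral measure *)

Section ComplexAux.
Variable R : realType.
Local Notation Re := (@complex.Re R).
Local Notation Im := (@complex.Im R).

Lemma normr_Re_le (z : R[i]) : `|Re z|%:C <= `|z|.
Proof.
rewrite normc_def lecR -sqrtr_sqr ler_wsqrtr// lerDl sqr_ge0//.
Qed.

Lemma normr_Im_le (z : R[i]) : `|Im z|%:C <= `|z|.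
Proof.
rewrite normc_def lecR -sqrtr_sqr ler_wsqrtr// lerDr sqr_ge0//.
Qed.

Lemma complex_ReB (z w : R[i]) : Re (z - w) = Re z - Re w.
Proof. by case: z w => [? ?] [? ?]. Qed.

Lemma complex_ImB (z w : R[i]) : Im (z - w) = Im z - Im w.
Proof. by case: z w => [? ?] [? ?]. Qed.

Lemma normc_le_ReIm (z : R[i]) : `|z| <= (`|Re z| + `|Im z|)%:C.
Proof.
rewrite normc_def lecR -[leRHS]ger0_norm ?addr_ge0// -sqrtr_sqr ler_wsqrtr//.
rewrite sqrrD !real_normK ?num_real//.
have : 0 <= `|Re z| * `|Im z| by rewrite mulr_ge0.
by rewrite -mulr_natl; lra.
Qed.

(** Connects a real point with the upper half-plane, the region where the Herglotz formula is
    available. *)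
Lemma derivable_vertical_lim (m : R[i] -> R[i]) (x : R) :
  derivable (m : R[i]^o -> R[i]^o) (x%:C : R[i]^o) 1 ->
  forall e : R, 0 < e -> exists2 d : R, 0 < d & forall h : R, 0 < h -> h < d ->
    `|Re (m (x +i* h)) - Re (m x%:C)| <= e /\
    `|Im (m (x +i* h)) - Im (m x%:C)| <= e.
Proof.
move=> /derivable1_diffP /differentiable_continuous mc e e0.
have e0' : (0 : R[i]) < e%:C by rewrite ltcR.
move/cvgrPdist_le : mc => /(_ _ e0') /nbhs_ballP[[d d'] /= d0 Hd].
move: d0; rewrite ltcE/= => /andP[/eqP d'0 d0].
exists d => // h h0 hd.
have := Hd (x +i* h); rewrite /ball/= => /(_ _) H.
have {H} /H : ball (x%:C : R[i]^o) (d +i* d') (x +i* h).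
  rewrite -ball_normE /ball_/= normc_def/= subrr expr0n/= add0r sub0r.
  by rewrite sqrtr_sqr normrN (gtr0_norm h0) ltcE/= d'0 eqxx.
rewrite -normrN opprB => H.
split; rewrite -lecR; apply: le_trans H.
  by rewrite -complex_ReB normr_Re_le.
by rewrite -complex_ImB normr_Im_le.
Qed.

Lemma herglotz_kernelE (x y l : R) :
  herglotz_kernel (x +i* y) l =
  ((l - x) / ((l - x) ^+ 2 + y ^+ 2) - l / (1 + l ^+ 2)) +i*
  (y / ((l - x) ^+ 2 + y ^+ 2)).
Proof.
have E : l%:C - (x +i* y) = (l - x) +i* (- y).
  by apply/eqP; rewrite eq_complex /= sub0r !eqxx.
have E' : ((l - x) +i* (- y))^-1 =
    ((l - x) / ((l - x) ^+ 2 + y ^+ 2)) +i* (y / ((l - x) ^+ 2 + y ^+ 2)).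
  by rewrite {1}/GRing.inv/= sqrrN mulNr opprK.
by apply/eqP; rewrite /herglotz_kernel E E' eq_complex /= subr0 !eqxx.
Qed.

End ComplexAux.

(** * A half-line without mass, from vanishing limits of Poisson integrals *)

Section NullSet.
Variable R : realType.
Variable rho : {measure set (measurableTypeR R) -> \bar R}.
Variables (p : R -> R -> R) (T : R).
Local Notation poisson x h := (fun l : R => h / ((l - x) ^+ 2 + h ^+ 2)).
Hypothesis pE : forall x h, 0 < h -> rho.-integrable setT (EFin \o poisson x h) /\
  Rintegral rho setT (poisson x h) = p x h.
Hypothesis p0 : forall x e, x < T -> 0 < e ->
  exists2 d, 0 < d & forall h, 0 < h -> h < d -> p x h <= e.

Let w (l : R) : R := (1 + l ^+ 2)^-1.

Let w_gt0 l : 0 < w l.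
Proof. by rewrite /w invr_gt0 ltr_wpDr ?sqr_ge0. Qed.

Let w_le1 l : w l <= 1.
Proof. by rewrite /w invf_le1 ?ltr_wpDr ?sqr_ge0// lerDl sqr_ge0. Qed.

Let int_w : rho.-integrable setT (EFin \o w).
Proof.
have [+ _] := @pE 0 1 ltr01; apply: eq_integrable => // l _ /=.
by rewrite subr0 expr1n mul1r addrC.
Qed.

Let int_wS (D : set R) : measurable D -> rho.-integrable D (EFin \o w).
Proof. by move=> mD; exact: integrableS int_w. Qed.

(** Distribution function of the measure [w] times [rho]; the weight makes it finite even if [rho]
    has infinite mass. *)
Let G (x : R) : R := Rintegral rho `]-oo, x] w.

Let GB (x y : R) : x <= y -> G y - G x = Rintegral rho `]x, y] w.
Proof.
move=> xy; rewrite /G (@itv_bndbnd_setU _ _ -oo%O (BRight x) (BRight y))//.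
rewrite Rintegral_setU//; first by rewrite addrC addKr.
- by apply: int_wS; exact: measurableU.
- apply/disj_setPRL => l /=; rewrite !in_itv/= => /andP[xl _].
  by apply/negP; rewrite -ltNge.
Qed.

Let Rint_le (x c d h : R) : 0 < h -> (forall l, c < l <= d -> `|l - x| <= h) ->
  0 <= Rintegral rho `]c, d] w <= 2 * h * p x h.
Proof.
move=> h0 cd; have [ip Ep] := @pE x h h0; apply/andP; split.
  by apply: Rintegral_ge0 => l _; exact: ltW (w_gt0 l).
have ip2 := integrableMl measurableT (2 * h) ip.
rewrite -Ep -RintegralZl//.
apply: (@le_trans _ _ (Rintegral rho `]c, d] (fun l => 2 * h * (h / ((l - x) ^+ 2 + h ^+ 2))))).
  apply: le_Rintegral => //; first exact: int_wS.
    exact: integrableS ip2.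
  move=> l /=; rewrite in_itv/= => /cd lx; apply: (le_trans (w_le1 l)).
  have h2 : 0 < (l - x) ^+ 2 + h ^+ 2 by rewrite ltr_wpDl ?sqr_ge0// exprn_gt0.
  have : (l - x) ^+ 2 <= h ^+ 2 by rewrite -[leLHS]real_normK ?num_real// lerXn2r// nnegrE// ltW.
  by rewrite mulrA ler_pdivlMr//; nra.
rewrite /Rintegral fine_le//.
- by apply: integrable_fin_num => //; exact: integrableS ip2.
- exact: integrable_fin_num.
apply: ge0_subset_integral => //; first exact: measurable_int ip2.
by move=> l _; rewrite lee_fin !mulr_ge0 ?invr_ge0 ?addr_ge0 ?sqr_ge0// ltW.
Qed.

(* Within distance [h] of [x] the Poisson kernel is at least [1 / (2 * h)], so [G]
   varies there by at most [2 * h * p x h = o(h)]. *)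
Let DG (x : R) : x < T -> is_derive x 1 G 0.
Proof.
move=> xT; apply/is_derive1_caratheodory.
pose g z := if z == x then 0 else (G z - G x) / (z - x).
have gP z : `|g z| <= if z == x then 0 else 2 * p x `|z - x|.
  rewrite /g; case: eqVneq => [_|zx]; first by rewrite normr0.
  have h0 : 0 < `|z - x| by rewrite normr_gt0 subr_eq0.
  rewrite normrM normfV ler_pdivrMr//.
  have [xz|/ltW xz] := leP x z.
    rewrite (GB xz) ger0_norm; last by apply: Rintegral_ge0 => l _; exact: ltW (w_gt0 l).
    suff: forall l, x < l <= z -> `|l - x| <= `|z - x|.
      by move=> /(Rint_le h0) /andP[_]; rewrite mulrAC.
    move=> l /andP[xl lz]; rewrite !ger0_norm ?subr_ge0// ?(ltW xl)//.
    by rewrite lerD2r.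
  rewrite distrC (GB xz) ger0_norm; last by apply: Rintegral_ge0 => l _; exact: ltW (w_gt0 l).
  suff: forall l, z < l <= x -> `|l - x| <= `|z - x|.
    by move=> /(Rint_le h0) /andP[_]; rewrite mulrAC.
  move=> l /andP[xl lz]; rewrite !ler0_norm ?subr_le0//.
  by rewrite !opprB lerD2l lerN2 ltW.
exists g; split.
- move=> z; rewrite /g; case: eqVneq => [->|zx]; first by rewrite !subrr mulr0.
  by rewrite divfK// subr_eq0.
- rewrite /prop_for/= /continuous_at {2}/g eqxx; apply/cvgr0Pnorm_le => e e0.
  have [d d0 Hd] := p0 xT (divr_gt0 e0 (ltr0n _ 2 : 0 < 2%:R)).
  apply/nbhs_ballP; exists d => //= z; rewrite /ball/= => xz.
  apply: (le_trans (gP z)); case: eqVneq => [_|zx]; first exact: ltW.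
  rewrite mulrC -ler_pdivlMr//; apply: Hd; first by rewrite normr_gt0 subr_eq0.
  by rewrite distrC.
- by rewrite /g eqxx.
Qed.

(** [G] has zero derivative below [T], hence is constant there, so [w] has integral zero over
    bounded intervals; on each of these [w] is bounded below by a positive constant. *)
Lemma measure_Ny_eq0 : rho `]-oo, T[%classic = 0.
Proof.
have int0 (c d : R) : c <= d -> d < T -> Rintegral rho `]c, d] w = 0.
  move=> cd dT; rewrite -GB//.
  have D z : z \in `]c, d[ -> is_derive z 1 G ((fun=> 0) z).
    by rewrite in_itv/= => /andP[_ zd]; apply: DG; exact: lt_trans dT.
  have cG : {within `[c, d], continuous G}.
    apply: continuous_in_subspaceT => z; rewrite inE/= in_itv/= => /andP[_ zd].
    by apply: is_derive1_continuous; apply: DG; exact: le_lt_trans dT.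
  by have [e _ ->] := MVT_segment cd D cG; rewrite mul0r.
have null (c d : R) : c <= d -> d < T -> rho `]c, d]%classic = 0.
  move=> cd dT.
  (* Chosen so that [C * w] is at least 1 on []c, d]]. *)
  pose C := 1 + (`|c| + `|d|) ^+ 2.
  have iC : rho.-integrable `]c, d] (EFin \o (fun l => C * w l)).
    by apply: integrableMl => //; exact: int_wS.
  have E : (\int[rho]_(l in `]c, d]) (C * w l)%:E = 0)%E.
    rewrite -[LHS]fineK; last exact: integrable_fin_num iC.
    rewrite -/(Rintegral rho `]c, d] (fun l => C * w l)) RintegralZl//.
      by rewrite int0// mulr0.
    exact: int_wS.
  apply/eqP; rewrite -measure_le0 -[leLHS]mul1e -integral_cst// -[leRHS]E.
  apply: ge0_le_integral => //.
  - exact: measurable_int iC.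
  - move=> l /=; rewrite in_itv/= => /andP[cl ld]; rewrite lee_fin /w.
    rewrite ler_pdivlMr ?ltr_wpDr ?sqr_ge0// mul1r lerD2l.
    rewrite -[leLHS]real_normK ?num_real// lerXn2r// ?nnegrE ?addr_ge0//.
    have := ler_norm (- c); have := ler_norm d.
    by rewrite normrN; move=> ? ?; rewrite ler_norml; apply/andP; split;
      [move: (normr_ge0 d)|move: (normr_ge0 c)]; lra.
apply/negligibleP => //.
have -> : `]-oo, T[%classic = \bigcup_n `]T - n.+2%:R, T - n.+1%:R^-1]%classic.
  apply/seteqP; split => [l|l [n _]] /=; rewrite !in_itv/=; last first.
    by move=> /andP[_ /le_lt_trans]; apply; rewrite gtrBl invr_gt0.
  move=> lT; have d0 : 0 < T - l by rewrite subr_gt0.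
  pose n := maxn (Num.trunc (T - l)) (Num.trunc (T - l)^-1).
  exists n => //=; rewrite in_itv/=; apply/andP; split.
    rewrite ltrBlDr -ltrBlDl; apply: (lt_le_trans (truncnS_gt _)).
    by rewrite ler_nat ltnS leqW// leq_maxl.
  rewrite lerBrDl -lerBrDr -[leRHS]invrK lef_pV2 ?posrE ?invr_gt0//.
  apply: (le_trans (ltW (truncnS_gt _))).
  by rewrite ler_nat ltnS leq_maxr.
apply: negligible_bigcup => n; apply/negligibleP => //; apply: null.
  rewrite lerD2l lerN2; apply: (@le_trans _ _ 1); last by rewrite ler1n.
  by rewrite invf_le1// ler1n.
by rewrite gtrBl invr_gt0.
Qed.

End NullSet.

Section RealHerglotz.
Variable R : realType.
Variables (m : R[i] -> R[i]) (rho : {measure set (measurableTypeR R) -> \bar R}).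
Hypothesis hrho : is_spectral_measure m rho.

Let w (l : R) : R := (1 + l ^+ 2)^-1.

Lemma spectral_Im (x h : R) : 0 < h ->
  rho.-integrable setT (EFin \o (fun l : R => h / ((l - x) ^+ 2 + h ^+ 2))) /\
  Rintegral rho setT (fun l : R => h / ((l - x) ^+ 2 + h ^+ 2)) = complex.Im (m (x +i* h)).
Proof.
move=> h0; have [[_ i2] ->] := @hrho (x +i* h) h0; split.
  by apply: eq_integrable i2 => // l _; rewrite /comp /Im_fun herglotz_kernelE.
rewrite /= add0r; apply: eq_Rintegral => l _.
by rewrite /Im_fun herglotz_kernelE.
Qed.

Lemma spectral_Re (x h : R) : 0 < h ->
  let g l := (l - x) / ((l - x) ^+ 2 + h ^+ 2) - l / (1 + l ^+ 2) in
  rho.-integrable setT (EFin \o g) /\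
  Rintegral rho setT g = complex.Re (m (x +i* h)) - complex.Re (m (0 +i* 1)).
Proof.
move=> h0 g; have [[i1 _] ->] := @hrho (x +i* h) h0; split.
  by apply: eq_integrable i1 => // l _; rewrite /comp /Re_fun herglotz_kernelE.
rewrite /= addrAC subrr add0r; apply: eq_Rintegral => l _.
by rewrite /Re_fun herglotz_kernelE.
Qed.

Lemma spectral_weight_integrable : rho.-integrable setT (EFin \o w).
Proof.
have [+ _] := @spectral_Im 0 1 ltr01; apply: eq_integrable => // l _ /=.
by rewrite subr0 expr1n mul1r addrC.
Qed.

Variables (K : R) (M : R -> R).
Hypothesis K0 : 0 <= K.
Hypothesis mc : forall x : R, x < - K ^+ 2 ->
  derivable (m : R[i]^o -> R[i]^o) (x%:C : R[i]^o) 1 /\ m x%:C = (M x)%:C.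

(** The Poisson integral of [rho] at [x + i h] is [Im m(x + i h)], which tends to [Im m(x) = 0]. *)
Lemma spectral_null : rho `]-oo, - K ^+ 2[%classic = 0.
Proof.
apply: (measure_Ny_eq0 spectral_Im) => x e xK e0.
have [dm mx] := mc xK.
have [d d0 Hd] := derivable_vertical_lim dm e0.
exists d => // h h0 hd; have [_] := Hd h h0 hd.
by rewrite mx /= subr0; apply: le_trans; rewrite ler_norm.
Qed.

Local Notation D := (`[- K ^+ 2, +oo[%classic : set R).

Lemma spectral_integral_half (g : R -> R) : measurable_fun setT g ->
  rho.-integrable D (EFin \o g) ->
  rho.-integrable setT (EFin \o g) /\ Rintegral rho setT g = Rintegral rho D g.
Proof.
move=> mg ig; pose N : set (measurableTypeR R) := `]-oo, - K ^+ 2[%classic.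
have mN : measurable N by exact: measurable_itv.
have DN : D = setT `\` N by rewrite setTD setCitvl.
have ig' : rho.-integrable setT (EFin \o g).
  have mg' : measurable_fun setT (EFin \o g) by exact/measurable_EFinP.
  have [_ +] := @negligible_integrable _ (measurableTypeR R) R rho setT N
    (EFin \o g) mN measurableT mg' spectral_null.
  by apply; rewrite -DN.
split=> //; rewrite /Rintegral (@negligible_integral _ (measurableTypeR R) R rho
  setT N (EFin \o g) mN measurableT ig' spectral_null).
by rewrite DN.
Qed.

(** Passage from [- y + i h] to the real point [- y] by dominated convergence as [h] tends to 0;
    once the null half-line is discarded, [l + y >= 1] keeps the kernels away from their
    singularity. *)
Lemma spectral_real (y : R) : - y < - K ^+ 2 -> K ^+ 2 + 1 <= y ->
  let g l := (l + y)^-1 - l / (1 + l ^+ 2) in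
  rho.-integrable D (EFin \o g) /\
  Rintegral rho D g = M (- y) - complex.Re (m (0 +i* 1)).
Proof.
move=> yK yK1 g; have [dm my] := mc yK.
pose h n : R := n.+1%:R^-1.
have h0 n : 0 < h n by rewrite invr_gt0.
have h1 n : h n <= 1 by rewrite invf_le1// ler1n.
pose gn n l := (l - - y) / ((l - - y) ^+ 2 + h n ^+ 2) - l / (1 + l ^+ 2).
have ign n : rho.-integrable D (EFin \o gn n).
  by have [i1 _] := spectral_Re (- y) (h0 n); exact: integrableS i1.
(* Put [s = l + y]. From [|l| <= (1 + y) s] and [s >= 1], the numerator of [gn n l] over the common
   denominator is at most [C s ^ 2]. *)
pose C := 3 + 2 * y + y * (1 + y).
have y1 : 1 <= y by have := sqr_ge0 K; lra.
have iC : rho.-integrable D (EFin \o (fun l => C * w l)).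
  by apply: integrableMl => //; apply: integrableS spectral_weight_integrable.
have bnd n l : D l -> `|gn n l| <= C * w l.
  rewrite /= in_itv/= andbT => Kl; rewrite /gn opprK.
  set s := l + y; have s1 : 1 <= s by rewrite /s; lra.
  have l2 : 0 < 1 + l ^+ 2 by rewrite ltr_wpDr ?sqr_ge0.
  have hh : 0 <= h n ^+ 2 <= 1.
    by rewrite sqr_ge0 /=; have := h0 n; have := h1 n; nra.
  have s2 : 0 < s ^+ 2 + h n ^+ 2 by case/andP: hh => ? _; nra.
  have -> : s / (s ^+ 2 + h n ^+ 2) - l / (1 + l ^+ 2) =
    ((s - y * l * s - l * h n ^+ 2) / (s ^+ 2 + h n ^+ 2)) * (1 + l ^+ 2)^-1.
    by rewrite /s; field; rewrite !gt_eqF.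
  rewrite /w normrM [X in _ * X]ger0_norm ?invr_ge0 ?(ltW l2)//.
  rewrite ler_wpM2r ?invr_ge0 ?(ltW l2)// normrM normfV (gtr0_norm s2) ler_pdivrMr//.
  have ls : `|l| <= (1 + y) * s.
    by rewrite ler_norml; apply/andP; split; rewrite /s in s1 *; nra.
  have s0 : 0 <= s by lra.
  have n1 : `|s - y * l * s - l * h n ^+ 2| <= s + y * `|l| * s + `|l|.
    apply: (le_trans (ler_normB _ _)); apply: lerD.
      apply: (le_trans (ler_normB _ _)); apply: lerD; first by rewrite ger0_norm.
      by rewrite !normrM (ger0_norm s0) (ger0_norm (le_trans ler01 y1)).
    rewrite normrM ler_piMr// ger0_norm; by case/andP: hh.
  apply: (le_trans n1).
  have sS : s <= s ^+ 2 by rewrite expr2 ler_peMl.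
  have l0 := normr_ge0 l.
  have e1 : y * `|l| * s <= y * ((1 + y) * s) * s.
    by rewrite ler_wpM2r// ler_wpM2l//; lra.
  have e2 : C * s ^+ 2 <= C * (s ^+ 2 + h n ^+ 2).
    by rewrite ler_wpM2l ?lerDl ?sqr_ge0//; rewrite /C; nra.
  apply: le_trans e2.
  have -> : C * s ^+ 2 = y * ((1 + y) * s) * s + (3 + 2 * y) * s ^+ 2 by rewrite /C; ring.
  have : (1 + y) * s <= (1 + y) * s ^+ 2 by rewrite ler_wpM2l//; lra.
  by have := sqr_ge0 s; nra.
have h_cvg : h n @[n --> \oo] --> (0 : R) by exact: cvg_harmonic.
have gn_cvg l : D l -> gn n l @[n --> \oo] --> g l.
  rewrite /= in_itv/= andbT => Kl; rewrite /gn /g opprK.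
  have s0 : 0 < l + y by lra.
  apply: cvgB; last exact: cvg_cst.
  have -> : (l + y)^-1 = (l + y) / ((l + y) ^+ 2 + 0 ^+ 2).
    by rewrite expr0n/= addr0; field; rewrite gt_eqF.
  apply: cvgMr; apply: cvgV; first by rewrite expr0n/= addr0 expf_neq0// gt_eqF.
  by apply: cvgD; [exact: cvg_cst|rewrite !expr2; exact: cvgM].
have gD n : Rintegral rho setT (gn n) = Rintegral rho D (gn n).
  have [i1 _] := spectral_Re (- y) (h0 n).
  have [|//] := spectral_integral_half _ (ign n).
  by apply/measurable_EFinP; exact: measurable_int i1.
have mg : measurable_fun D (EFin \o g).
  apply/measurable_EFinP; apply: measurable_fun_cvg gn_cvg => n.
  by apply/measurable_EFinP; exact: measurable_int (ign n).
have [||||ig _ cvg_int] := @dominated_convergence _ _ _ rho D (measurable_itv _)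
  (fun n => EFin \o gn n) (EFin \o g) (EFin \o (fun l => C * w l)) _ mg.
- by move=> n; exact: measurable_int (ign n).
- by apply: aeW => l Dl; apply: cvg_EFin; [exact: nearW|exact: gn_cvg].
- exact: iC.
- by apply: aeW => l n Dl; rewrite /= lee_fin; exact: bnd.
split=> //.
have cR : Rintegral rho D (gn n) @[n --> \oo] --> Rintegral rho D g.
  apply: fine_cvg; rewrite fineK; last exact: integrable_fin_num ig.
  exact: cvg_int.
have cM : Rintegral rho D (gn n) @[n --> \oo] --> M (- y) - complex.Re (m (0 +i* 1)).
  have -> : (fun n => Rintegral rho D (gn n)) =
      (fun n => complex.Re (m ((- y) +i* h n)) - complex.Re (m (0 +i* 1))).
    by apply/funext => n; rewrite -gD; have [_ ->] := spectral_Re (- y) (h0 n).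
  apply: cvgB; last exact: cvg_cst.
  apply/cvgrPdist_le => e e0; have [d d0 Hd] := derivable_vertical_lim dm e0.
  have hd : \forall n \near \oo, h n < d by exact: (cvgr_lt 0 h_cvg).
  apply: filterS hd => n hnd; have [+ _] := Hd _ (h0 n) hnd.
  by rewrite my /= distrC.
exact: cvg_unique cR cM.
Qed.

Section Functional.
Variable N : nat.
Hypothesis KN : K + 2 <= N%:R.

Lemma spectral_trans_integrable F B : jet F -> exp_bounded N B F ->
  measurable_fun D (sin_trans F) ->
  rho.-integrable D (EFin \o sin_trans F) /\
  `|Rintegral rho D (sin_trans F)| <= 2 * Rintegral rho D w * B.
Proof.
move=> jF bF mF.
have iw : rho.-integrable D (EFin \o w).
  by apply: integrableS spectral_weight_integrable.
have iB : rho.-integrable D (EFin \o (fun l => 2 * B * w l)) by exact: integrableMl.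
have le l : D l -> `|sin_trans F l| <= 2 * B * w l.
  by rewrite /= in_itv/= andbT => Kl; exact: (sin_trans_le K0 KN).
have ig : rho.-integrable D (EFin \o sin_trans F).
  apply: le_integrable iB => //; first exact/measurable_EFinP.
  by move=> l Dl; rewrite lee_fin /=; apply: (le_trans (le l Dl)); rewrite ler_norm.
split=> //; apply: (le_trans (le_normr_Rintegral _ ig)) => //.
have -> : 2 * Rintegral rho D w * B = Rintegral rho D (fun l => 2 * B * w l).
  by rewrite RintegralZl//; ring.
by apply: le_Rintegral => //; exact: integrable_norm ig.
Qed.

Lemma spectral_bounded_functional :
  bounded_functional (fun F => measurable_fun D (sin_trans F)) N
    (fun F => Rintegral rho D (sin_trans F)).
Proof.
split.
  exists (2 * Rintegral rho D w).
    by rewrite mulr_ge0// Rintegral_ge0// => l _; rewrite /w invr_ge0 addr_ge0 ?sqr_ge0.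
  by move=> F B mF jF bF; have [] := spectral_trans_integrable jF bF mF.
move=> F G a B B' mF mG jF jG bF bG.
have [iF _] := spectral_trans_integrable jF bF mF.
have [iG _] := spectral_trans_integrable jG bG mG.
rewrite -RintegralD_Ml//; apply: eq_Rintegral => l.
by rewrite inE/= in_itv/= andbT => Kl; exact: (sin_transD K0 KN _ jF jG bF bG).
Qed.

(** Exponentials do not have compact support, so measurability is read off their explicit
    transform. *)
Lemma sin_trans_measurable_exp n : (N <= n)%N ->
  measurable_fun D (sin_trans (@exp_jet R n)).
Proof.
move=> Nn; have sub : D `<=` `]- K ^+ 2 - 1, +oo[.
  by move=> l /=; rewrite !in_itv/= !andbT; lra.
apply: (@eq_measurable_fun _ _ R R _ (fun l => (l + n%:R ^+ 2)^-1 - l / (1 + l ^+ 2))).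
  by move=> l; rewrite inE/= in_itv/= andbT => Kl; rewrite (sin_trans_exp K0 KN Nn Kl).
apply: (measurable_funS _ sub) => //; apply: open_continuous_measurable_fun.
  exact: interval_open.
move=> l; rewrite inE/= in_itv/= andbT => Kl; apply: herglotz_continuous.
have : K + 2 <= n%:R by rewrite (le_trans KN)// ler_nat.
by have := K0; nra.
Qed.

Lemma spectral_exp n : (N <= n)%N -> Rintegral rho D (sin_trans (exp_jet n)) =
  M (- n%:R ^+ 2) - complex.Re (m (0 +i* 1)).
Proof.
move=> Nn; have Kn : K + 2 <= n%:R by rewrite (le_trans KN)// ler_nat.
have Kn2 : K ^+ 2 + 1 <= n%:R ^+ 2 by have := K0; nra.
have [|_ <-] := @spectral_real (n%:R ^+ 2) _ Kn2; first by rewrite ltrN2; lra.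
apply: eq_Rintegral => l; rewrite inE/= in_itv/= andbT => Kl.
exact: (sin_trans_exp K0 KN).
Qed.

End Functional.

End RealHerglotz.

(** * The functionals on the right-hand side *)

Section EvenIntegral.
Variable R : realType.
Local Notation mu := (@lebesgue_measure R).

(** Reflection preserves Lebesgue measure; the change of variables is applied to the positive and
    negative parts, and the origin is a null set. *)
Lemma Rintegral_even (h : R -> R) : (forall x, h (- x) = h x) ->
  mu.-integrable `]0, +oo[ (EFin \o h) ->
  Rintegral mu setT h = 2 * Rintegral mu `]0, +oo[ h.
Proof.
move=> hN ih.
have mh : measurable_fun (`]0, +oo[ : set R) (EFin \o h) := measurable_int _ ih.
have opp_pre : `]-oo, 0[%classic = (-%R : R -> measurableTypeR R) @^-1` `]0, +oo[%classic.
  by apply/seteqP; split => x /=; rewrite !in_itv/= andbT oppr_gt0.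
have mhN : measurable_fun (`]-oo, 0[ : set R) (EFin \o h).
  have -> : EFin \o h = (EFin \o h) \o (-%R : R -> R).
    by apply/funext => x /=; rewrite hN.
  apply: (measurable_comp _ _ mh) => //.
  by move=> _ [x /= + <-]; rewrite !in_itv/= andbT oppr_gt0.
have ge0E (f : R -> \bar R) : measurable_fun (`]0, +oo[ : set R) f ->
    (forall x, 0 <= f x)%E -> (forall x, f (- x) = f x) ->
    (\int[mu]_(x in `]-oo, 0%R[) f x = \int[mu]_(x in `]0%R, +oo[) f x)%E.
  move=> mf f0 fN; rewrite opp_pre; apply/esym.
  transitivity (\int[pushforward mu (-%R : R -> measurableTypeR R)]_(x in `]0%R, +oo[) f x)%E.
    by apply: eq_measure_integral => A mA _; exact/esym/lebesgue_measureN.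
  rewrite ge0_integral_pushforward//; first by apply: eq_integral => x _ /=.
have mT : measurable_fun (setT : set R) (EFin \o h).
  rewrite -(setvU `]-oo, 0[%classic) setCitvl.
  apply/measurable_funU => //; split=> //.
  exact/emeasurable_fun_itv_obnd_cbndP.
have E : (\int[mu]_(x in setT) (h x)%:E =
    \int[mu]_(x in `]0%R, +oo[) (h x)%:E + \int[mu]_(x in `]0%R, +oo[) (h x)%:E)%E.
  rewrite -[in LHS](setvU `]-oo, 0[%classic) setCitvl.
  rewrite integral_setU//; last 2 first.
  - by rewrite -setCitvl setvU.
  - by apply/disj_setPRL => x /=; rewrite !in_itv/= andbT => x0; apply/negP; rewrite -ltNge.
  rewrite -integral_itv_obnd_cbnd//; congr (_ + _)%E.
  rewrite [LHS]integralE [RHS]integralE; congr (_ - _)%E; apply: ge0E => //.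
  - exact: measurable_funepos.
  - by move=> x; rewrite !funeposE hN.
  - exact: measurable_funeneg.
  - by move=> x; rewrite !funenegE hN.
rewrite /Rintegral E fineD ?integrable_fin_num//.
by rewrite mulrDl mul1r.
Qed.

End EvenIntegral.

Section RegularFunctional.
Variable R : realType.
Local Notation mu := (@lebesgue_measure R).
Local Notation E c := (fun x : R => expR (- (c * x))).

Lemma laplace_test_integrable (A F : R -> R) (c B : R) : continuous F ->
  mu.-integrable `]0, +oo[ (EFin \o (fun x => A x * E c x)) ->
  (forall x, 0 <= x -> `|F x| <= B * E c x) ->
  mu.-integrable `]0, +oo[ (EFin \o (fun x => A x * F x)) /\
  `|Rintegral mu `]0, +oo[ (fun x => A x * F x)| <=
    B * Rintegral mu `]0, +oo[ (fun x => `|A x * E c x|).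
Proof.
move=> cF iA FB.
have B0 : 0 <= B.
  by have := le_trans (normr_ge0 _) (FB 0 (lexx 0)); rewrite mulr0 oppr0 expR0 mulr1.
have mAE : measurable_fun (`]0, +oo[ : set R) (fun x => A x * E c x).
  by apply/measurable_EFinP; exact: measurable_int iA.
have mA : measurable_fun (`]0, +oo[ : set R) A.
  (* Measurability of [A] is recovered by multiplying the weighted function by the inverse
     exponential. *)
  have -> : A = (fun x => (A x * E c x) * E (- c) x).
    by apply/funext => x; rewrite -mulrA -expRD mulNr opprK addNr expR0 mulr1.
  apply: measurable_funM => //; apply: measurable_funTS.
  by apply: continuous_measurable_fun; exact: continuous_expN.
have mAF : measurable_fun (`]0, +oo[ : set R) (fun x => A x * F x).
  by apply: measurable_funM => //; apply: measurable_funTS; exact: continuous_measurable_fun.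
have iN : mu.-integrable `]0, +oo[ (EFin \o (fun x => `|A x * E c x|)).
  exact: integrable_norm iA.
have iB : mu.-integrable `]0, +oo[ (EFin \o (fun x => B * `|A x * E c x|)).
  exact: integrableMl.
have le x : `]0, +oo[%classic x -> `|A x * F x| <= B * `|A x * E c x|.
  rewrite /= in_itv/= andbT => /ltW x0; rewrite !normrM mulrCA ler_wpM2l//.
  by rewrite (ger0_norm (expR_ge0 _)) FB.
have iAF : mu.-integrable `]0, +oo[ (EFin \o (fun x => A x * F x)).
  apply: le_integrable iB => //; first exact/measurable_EFinP.
  by move=> x x0; rewrite lee_fin /=; apply: (le_trans (le x x0)); rewrite ler_norm.
split=> //; rewrite -RintegralZl//.
apply: (le_trans (le_normr_Rintegral _ iAF)) => //.
by apply: le_Rintegral => //; exact: integrable_norm iAF.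
Qed.

Lemma regular_bounded_functional P (A : R -> R) (N : nat) :
  mu.-integrable `]0, +oo[ (EFin \o (fun x => A x * E (2 * N%:R) x)) ->
  bounded_functional P N (fun F => Rintegral mu `]0, +oo[ (fun x => A x * F 0%N x)).
Proof.
move=> iA.
have H (F : nat -> R -> R) B : jet F -> exp_bounded N B F ->
  mu.-integrable `]0, +oo[ (EFin \o (fun x => A x * F 0%N x)) /\
  `|Rintegral mu `]0, +oo[ (fun x => A x * F 0%N x)| <=
    B * Rintegral mu `]0, +oo[ (fun x => `|A x * E (2 * N%:R) x|).
  move=> jF bF; apply: laplace_test_integrable => //.
    by move=> x; exact: is_derive1_continuous (jF 0%N x).
  by move=> x x0; exact: bF.
split.
  exists (Rintegral mu `]0, +oo[ (fun x => `|A x * E (2 * N%:R) x|)).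
    by apply: Rintegral_ge0 => x _.
  by move=> F B _ jF bF; have [_] := H F B jF bF; rewrite mulrC.
move=> F G a B B' _ _ jF jG bF bG.
have [iF _] := H _ _ jF bF; have [iG _] := H _ _ jG bG.
by rewrite -RintegralD_Ml//; apply: eq_Rintegral => x _; rewrite mulrDr mulrCA.
Qed.

(* The growth bound only controls [A] on bounded intervals: sum over unit
   intervals, on which the exponential weight gains a factor 1/2 each time. *)
Lemma growth_laplace_integrable (A : R -> R) (C K c : R) :
  (forall a, 0 < a -> mu.-integrable `]0, a[ (EFin \o A)) ->
  (forall a, 0 < a -> Rintegral mu `]0, a[ (fun x => `|A x|) <= C * expR (K * a)) ->
  `|K| + 1 <= c ->
  mu.-integrable `]0, +oo[ (EFin \o (fun x => A x * E c x)).
Proof.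
move=> iA AC Kc; have c0 : 0 <= c by have := normr_ge0 K; lra.
pose h x := `|A x * E c x|.
pose I n : set (measurableTypeR R) := `]0, n.+1%:R[%classic.
have mI n : measurable (I n) by exact: measurable_itv.
have mA n : measurable_fun (I n) A.
  by apply/measurable_EFinP; exact: measurable_int (iA n.+1%:R (ltr0Sn _ _)).
have mAE n : measurable_fun (I n) (fun x => A x * E c x).
  apply: measurable_funM => //; apply: measurable_funTS.
  by apply: continuous_measurable_fun; exact: continuous_expN.
have ih n : mu.-integrable (I n) (EFin \o h).
  apply: (le_integrable (mI n) _ _ (iA n.+1%:R (ltr0Sn _ _))).
    by apply/measurable_EFinP; apply: measurableT_comp.
  move=> x; rewrite /I /= in_itv/= => /andP[/ltW x0 _]; rewrite lee_fin /h normr_id normrM.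
  rewrite ler_piMr// ger0_norm ?expR_ge0// -expR0 ler_expR oppr_le0 mulr_ge0//.
have inA n : mu.-integrable (I n) (EFin \o (fun x => `|A x|)).
  exact: integrable_norm (iA n.+1%:R (ltr0Sn _ _)).
have IE : `]0, +oo[%classic = \bigcup_n I n.
  apply/seteqP; split => [x|x [n _]]; rewrite /I /= !in_itv/= andbT; last by case/andP.
  by move=> x0; exists (Num.trunc x); rewrite //= in_itv/= x0 truncnS_gt.
pose C1 := `|C| * expR `|K|.
have C10 : 0 <= C1 by rewrite mulr_ge0 ?expR_ge0.
(* [2 - 2^-1 ^+ n] is the sum of [2^-1 ^+ k] over [k <= n], one term per unit interval. *)
have bound n : Rintegral mu (I n) h <= C1 * (2 - 2^-1 ^+ n).
  elim: n => [|n IH].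
    rewrite expr0 (_ : 2 - 1 = 1 :> R) ?mulr1; last by ring.
    apply: (@le_trans _ _ (Rintegral mu (I 0%N) (fun x => `|A x|))).
      apply: le_Rintegral => //.
      move=> x; rewrite /I /= in_itv/= => /andP[/ltW x0 _]; rewrite /h normrM.
      by rewrite ler_piMr// ger0_norm ?expR_ge0// -expR0 ler_expR oppr_le0 mulr_ge0.
    apply: (le_trans (AC 1 ltr01)); rewrite mulr1 /C1.
    apply: (le_trans (ler_wpM2r (expR_ge0 _) (ler_norm C))).
    by rewrite ler_wpM2l// ler_expR ler_norm.
  pose J : set (measurableTypeR R) := `[n.+1%:R, n.+2%:R[%classic.
  have IS : I n.+1 = I n `|` J.
    by rewrite /I /J -itv_bndbnd_setU// bnd_simp ?ltr0n// ler_nat.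
  have JI : J `<=` I n.+1 by rewrite IS; exact: subsetUr.
  have mJ : measurable J by exact: measurable_itv.
  rewrite IS Rintegral_setU//; last 2 first.
  - by rewrite -IS.
  - apply/disj_setPRL => x; rewrite /I /J /= !in_itv/= => /andP[nx _].
    by move=> /andP[_]; rewrite ltNge nx.
  have : Rintegral mu J h <= C1 * 2^-1 ^+ n.+1.
    have iJ := integrableS (mI n.+1) mJ JI (ih n.+1).
    have iJA := integrableS (mI n.+1) mJ JI (inA n.+1).
    apply: (@le_trans _ _ (Rintegral mu J (fun x => expR (- (c * n.+1%:R)) * `|A x|))).
      apply: le_Rintegral => //; first exact: integrableMl.
      move=> x; rewrite /J /= in_itv/= => /andP[nx _]; rewrite /h normrM mulrC.
      rewrite ler_wpM2r// ger0_norm ?expR_ge0// ler_expR lerN2 ler_wpM2l//.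
    rewrite RintegralZl//.
    apply: (@le_trans _ _ (expR (- (c * n.+1%:R)) * Rintegral mu (I n.+1) (fun x => `|A x|))).
      rewrite ler_wpM2l ?expR_ge0// IS Rintegral_setU//.
      - by rewrite lerDr Rintegral_ge0.
      - by rewrite -IS.
      - apply/disj_setPRL => x; rewrite /I /J /= !in_itv/= => /andP[nx _].
        by move=> /andP[_]; rewrite ltNge nx.
    have h1 : Rintegral mu (I n.+1) (fun x => `|A x|) <= C1 * expR (`|K| * n.+1%:R).
      apply: (le_trans (AC n.+2%:R (ltr0Sn _ _))).
      apply: (le_trans (ler_wpM2r (expR_ge0 _) (ler_norm C))).
      rewrite /C1 -mulrA -expRD ler_wpM2l// ler_expR.
      have -> : `|K| + `|K| * n.+1%:R = `|K| * n.+2%:R by rewrite -[n.+2%:R]natr1; ring.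
      by rewrite ler_wpM2r// ler_norm.
    apply: (le_trans (ler_wpM2l (expR_ge0 _) h1)).
    rewrite mulrCA -expRD ler_wpM2l//.
    have e1 : expR (-1) <= 2^-1 :> R.
      by rewrite expRN lef_pV2 ?posrE ?expR_gt0//; have := expR_ge1Dx (1 : R); lra.
    apply: (@le_trans _ _ (expR (-1) ^+ n.+1)).
      rewrite -expRM_natr ler_expR.
      have -> : - (c * n.+1%:R) + `|K| * n.+1%:R = (`|K| - c) * n.+1%:R by ring.
      by rewrite ler_wpM2r//; lra.
    by rewrite lerXn2r// ?nnegrE ?expR_ge0// invr_ge0.
  move=> HJ; apply: (le_trans (lerD IH HJ)).
  by rewrite -mulrDr ler_wpM2l// exprS; lra.
rewrite IE; apply/integrableP; split.
  apply/measurable_fun_bigcup => // n.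
  by apply/measurable_EFinP; exact: mAE.
have nd : {homo I : n m / (n <= m)%N >-> (n <= m)%O}.
  move=> n k nk; apply/subsetPset => x; rewrite /I /= !in_itv/= => /andP[-> /lt_le_trans].
  by apply; rewrite ler_nat.
have cv := @ge0_nondecreasing_set_cvg_integral _ _ _ I (fun x => (h x)%:E) mu nd mI _ _.
have {cv} cv : (\int[mu]_(x in I n) (h x)%:E)%E @[n --> \oo] -->
    (\int[mu]_(x in \bigcup_n I n) (h x)%:E)%E.
  by apply: cv => [n|n x _]; [exact: measurable_int (ih n)|rewrite lee_fin normr_ge0].
rewrite -(cvg_lim _ cv)//; apply: (@le_lt_trans _ _ (C1 * 2)%:E); last exact: ltry.
apply: lime_le; first by apply/cvg_ex; eexists; exact: cv.
near=> n; rewrite -[leLHS]fineK; last exact: integrable_fin_num (ih n).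
rewrite lee_fin; apply: (le_trans (bound n)); rewrite ler_wpM2l//.
by rewrite gerBl exprn_ge0// invr_ge0.
Unshelve. all: by end_near. Qed.

End RegularFunctional.

Section SeriesFunctional.
Variable R : realType.

Definition rseries (a : nat -> R) : R := limn (fun n => \sum_(1 <= j < n) a j).

(** A zero term in front turns sums from [j = 1] into series indexed from 0. *)
Let shift (a : nat -> R) j : R := if j is 0%N then 0 else a j.

Let sum_shift a : (fun n => \sum_(1 <= j < n) a j) = series (shift a).
Proof.
apply/funext => -[|n]; first by rewrite /series /= !big_geq.
rewrite /series /= [RHS]big_ltn//= add0r.
by apply: eq_big_nat => -[|j].
Qed.

Lemma rseries_cvg (a : nat -> R) (B q : R) : 0 <= q -> q < 1 ->
  (forall j, (0 < j)%N -> `|a j| <= B * q ^+ j) -> 0 <= B ->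
  (\sum_(1 <= j < n) a j @[n --> \oo] --> rseries a) /\ `|rseries a| <= B / (1 - q).
Proof.
move=> q0 q1 aB B0; rewrite /rseries sum_shift.
have q1' : `|q| < 1 by rewrite ger0_norm.
have le j : `|shift a j| <= geometric B q j.
  case: j => [|j] /=; first by rewrite normr0 mulr_ge0// exprn_ge0.
  exact: aB.
have cn : cvgn [normed series (shift a)].
  apply: (series_le_cvg _ _ le); [by []| |exact: is_cvg_geometric_series].
  by move=> j; rewrite /geometric /= mulr_ge0// exprn_ge0.
split; first exact: normed_cvg.
apply: (le_trans (lim_series_norm cn)).
rewrite -(cvg_lim (@Rhausdorff R) (cvg_geometric_series (a := B) q1')).
by apply: lim_series_le => //; exact: is_cvg_geometric_series.
Qed.

Variables (b C : R) (c : nat -> R) (i N : nat).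
Hypotheses (b0 : 0 < b) (N0 : (0 < N)%N) (i4 : (i <= 4)%N).
Hypothesis cC : forall j, (0 < j)%N -> `|c j| <= C * j%:R.

(** Linear growth of the coefficients costs half of the exponent: [b j <= exp (b j)] and [N >= 1]
    leave a geometric series of ratio [exp (- b)]. The factor [C / b] comes from writing
    [j = (b j) / b]. *)
Lemma series_functional_cvg F B : exp_bounded N B F ->
  (\sum_(1 <= j < n) c j * F i (b * j%:R) @[n --> \oo] -->
    rseries (fun j => c j * F i (b * j%:R))) /\
  `|rseries (fun j => c j * F i (b * j%:R))| <= C / b / (1 - expR (- b)) * B.
Proof.
move=> bF.
have B0 : 0 <= B.
  have := le_trans (normr_ge0 _) (bF 0%N 0 isT (lexx 0)).
  by rewrite mulr0 oppr0 expR0 mulr1.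
have C0 : 0 <= C by have := le_trans (normr_ge0 _) (cC (ltn0Sn 0)); rewrite mulr1.
have q1 : expR (- b) < 1 by rewrite -expR0 ltr_expR oppr_lt0.
have -> : C / b / (1 - expR (- b)) * B = (C / b * B) / (1 - expR (- b)).
  by field; rewrite !gt_eqF// subr_gt0.
apply: rseries_cvg => //.
  move=> j j0; rewrite normrM.
  have bj0 : 0 <= b * j%:R by rewrite mulr_ge0// ltW.
  apply: (le_trans (ler_pM (normr_ge0 _) (normr_ge0 _) (cC j0) (bF i _ i4 bj0))).
  have e1 : b * j%:R <= expR (b * j%:R) by have := expR_ge1Dx (b * j%:R); lra.
  have e2 : expR (- (2 * N%:R * (b * j%:R))) <= expR (- (2 * (b * j%:R))).
    rewrite ler_expR lerN2 ler_wpM2r// ler_peMr//.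
    by rewrite ler1n.
  apply: (@le_trans _ _ (C / b * B * ((b * j%:R) * expR (- (2 * (b * j%:R)))))).
    have -> : C / b * B * (b * j%:R * expR (- (2 * (b * j%:R)))) =
      C * j%:R * (B * expR (- (2 * (b * j%:R)))) by field; rewrite gt_eqF.
    by rewrite ler_wpM2l ?mulr_ge0// ler_wpM2l.
  rewrite ler_wpM2l ?mulr_ge0 ?invr_ge0 ?(ltW b0)//.
  rewrite -expRM_natr.
  have -> : expR (- b * j%:R) = expR (b * j%:R) * expR (- (2 * (b * j%:R))).
    by rewrite -expRD; congr expR; ring.
  by rewrite ler_wpM2r ?expR_ge0.
by rewrite mulr_ge0// divr_ge0// ltW.
Qed.

Lemma series_bounded_functional P :
  bounded_functional P N (fun F => rseries (fun j => c j * F i (b * j%:R))).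
Proof.
have C0 : 0 <= C by have := le_trans (normr_ge0 _) (cC (ltn0Sn 0)); rewrite mulr1.
split.
  exists (C / b / (1 - expR (- b))).
    by rewrite !divr_ge0// ?(ltW b0)// subr_ge0 -expR0 ler_expR oppr_le0 ltW.
  by move=> F B _ _ bF; have [] := series_functional_cvg bF.
move=> F G a B B' _ _ _ _ bF bG.
have [cF _] := series_functional_cvg bF; have [cG _] := series_functional_cvg bG.
apply: cvg_lim => //.
have -> : (fun n => \sum_(1 <= j < n) c j * (F i (b * j%:R) + a * G i (b * j%:R))) =
  (fun n => \sum_(1 <= j < n) c j * F i (b * j%:R) +
            a * \sum_(1 <= j < n) c j * G i (b * j%:R)).
  apply/funext => n; rewrite mulr_sumr -big_split/=; apply: eq_bigr => j _.
  by rewrite mulrDr mulrCA.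
by apply: cvgD => //; exact: cvgMr.
Qed.

End SeriesFunctional.

Section FunctionalSum.
Variable R : realType.
Implicit Types (P : (nat -> R -> R) -> Prop) (N : nat).

Lemma bounded_functional_eval P N i (x0 : R) : (i <= 4)%N -> 0 <= x0 ->
  bounded_functional P N (fun F => F i x0).
Proof.
move=> i4 x00; split=> //; exists 1 => // F B _ _ bF; rewrite mul1r.
have B0 : 0 <= B.
  have := le_trans (normr_ge0 _) (bF 0%N 0 isT (lexx 0)).
  by rewrite mulr0 oppr0 expR0 mulr1.
apply: (le_trans (bF i x0 i4 x00)); rewrite ler_piMr// -expR0 ler_expR oppr_le0.
by rewrite !mulr_ge0.
Qed.

Lemma bounded_functional_sub (P Q : (nat -> R -> R) -> Prop) N T :
  (forall F, P F -> Q F) -> bounded_functional Q N T -> bounded_functional P N T.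
Proof.
move=> PQ [[C C0 TC] Tl]; split; first by exists C => // F B /PQ; exact: TC.
by move=> F G a B B' /PQ QF /PQ; exact: Tl.
Qed.

Lemma bounded_functional_comb P N S T (a : R) :
  bounded_functional P N S -> bounded_functional P N T ->
  bounded_functional P N (fun F => S F + a * T F).
Proof.
move=> [[C C0 SC] Sl] [[C' C'0 TC] Tl]; split.
  exists (C + `|a| * C'); first by rewrite addr_ge0// mulr_ge0.
  move=> F B PF jF bF; rewrite (le_trans (ler_normD _ _))// [leRHS]mulrDl lerD ?SC//.
  by rewrite normrM -[leRHS]mulrA ler_wpM2l// TC.
move=> F G c B B' PF PG jF jG bF bG.
by rewrite (Sl F G c B B')// (Tl F G c B B')//; ring.
Qed.

End FunctionalSum.

(** * The identity for real odd test functions *)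

Section OddTest.
Variable R : realType.
Local Notation mu := (@lebesgue_measure R).

(** The half-line is open, so the function vanishes near each of its points and the next derivative
    vanishes too. *)
Lemma jet_eq0_gt (F : nat -> R -> R) (a : R) : jet F ->
  (forall x, a < x -> F 0%N x = 0) -> forall i x, a < x -> F i x = 0.
Proof.
move=> jF F0; elim=> [|i IH] x ax; first exact: F0.
have D : is_derive x 1 (cst (0 : R)) (F i.+1 x).
  apply: near_eq_is_derive (jF i x).
  near=> y; rewrite IH//; near: y.
  exact: lt_nbhsr.
by have [_ <-] := D; rewrite derive_cst.
Unshelve. all: by end_near. Qed.

Variables (u : R -> R) (a : R).
Hypotheses (su : forall n (x : R), derivable (u^`(n))%classic x 1)
  (u0 : forall x, a < x -> u x = 0) (uN : forall x, u (- x) = - u x).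

Definition derive_jet : nat -> R -> R := fun i => (u^`(i))%classic.

Lemma jet_derive : jet derive_jet.
Proof.
move=> i x; rewrite /derive_jet derive1nS derive1E.
exact/derivableP.
Qed.

Lemma derive_jet_eq0 i x : a + 1 <= x -> derive_jet i x = 0.
Proof. by move=> ax; apply: (jet_eq0_gt jet_derive u0); lra. Qed.

Lemma odd_eq0 : u 0 = 0.
Proof. by have := uN 0; rewrite oppr0; lra. Qed.

Lemma derive1_odd x : (u^`())%classic (- x) = (u^`())%classic x.
Proof.
have D (y : R) : is_derive y 1 u ((u^`())%classic y) := jet_derive 0 y.
have DN : is_derive x 1 (fun t : R => - t) (-1 : R).
  by have := @is_deriveN R R R id x 1 1 (is_derive_id x (1 : R)).
have D1 : is_derive x 1 (fun t => -1 * u t) (-1 * (u^`())%classic x).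
  exact: is_derive1Ml.
have D2 := @is_derive1_comp _ u (fun t => - t) x _ _ (D (- x)) DN.
have E : (fun t => -1 * u t) = u \o (fun t => - t).
  by apply/funext => t /=; rewrite uN mulN1r.
rewrite E in D1; have [_ e1] := D1; have [_ e2] := D2.
by move: e1; rewrite e2; lra.
Qed.

(** The product of two odd functions is even, which folds the line onto the half-line, and [u 0 = 0]
    removes the counterterm of [sin_trans]. *)
Lemma sin_trans_odd (l : R) :
  Rintegral mu setT (fun x => u x * sin_kernel x l) = sin_trans derive_jet l.
Proof.
(* Here [l] is fixed, so [K] and [N] may depend on it; they serve to make the integral converge. *)
pose K := `|l| + 1; have K0 : 0 <= K by rewrite addr_ge0.
pose N := (Num.trunc (K + 2)).+1.
have KN : K + 2 <= N%:R by apply/ltW/truncnS_gt.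
have Kl : - K ^+ 2 <= l.
  by have := ler_norm (- l); rewrite normrN /K; have := normr_ge0 l; nra.
have [B bB] := jet_exp_bounded N jet_derive derive_jet_eq0.
have [iS _] := sin_integral_integrable K0 KN jet_derive bB (isT : (0 <= 4)%N) Kl.
have iS' : mu.-integrable `]0, +oo[ (EFin \o (fun x => u x * sin_kernel x l)).
  apply: integrableS iS => // x /=; rewrite !in_itv/= !andbT; exact: ltW.
rewrite Rintegral_even//; last by move=> x; rewrite uN sin_kernelN mulrNN.
by rewrite Rintegral_itv_obnd_cbnd// /sin_trans /derive_jet /= odd_eq0 mul0r subr0.
Qed.

Lemma regular_odd (A : R -> R) (N : nat) :
  mu.-integrable `]0, +oo[ (EFin \o (fun x => A x * expR (- (2 * N%:R * x)))) ->
  Rintegral mu setT (fun x => (\1_(`]0, +oo[ : set R) x * A x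
      - \1_(`]-oo, 0[ : set R) x * A (- x)) * u x) =
  2 * Rintegral mu `]0, +oo[ (fun x => A x * u x).
Proof.
move=> iA; have [B bB] := jet_exp_bounded N jet_derive derive_jet_eq0.
have [||iAu _] := @laplace_test_integrable R A u (2 * N%:R) B _ iA.
- by move=> x; exact: is_derive1_continuous (jet_derive 0 x).
- by move=> x x0; exact: (bB 0%N).
have E x : `]0, +oo[%classic x -> A x * u x = (\1_(`]0, +oo[ : set R) x * A x
      - \1_(`]-oo, 0[ : set R) x * A (- x)) * u x.
  rewrite /= in_itv/= andbT => x0; rewrite !indicE mem_set/=; last by rewrite in_itv/= x0.
  by rewrite memNset/= ?in_itv/= ?mul1r ?mul0r ?subr0//; apply/negP; rewrite -leNgt ltW.
rewrite Rintegral_even.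
- by congr (_ * _); apply: eq_Rintegral => x /set_mem /E.
- move=> x; rewrite uN opprK !indicE !mem_setE !in_itv/= !andbT oppr_gt0 oppr_lt0.
  ring.
- by apply: eq_integrable iAu => // x /set_mem /E /= ->.
Qed.

End OddTest.

(** * The real identity, with the endpoint terms abstracted as [W] *)

Section RealIdentity.
Variable R : realType.
Local Notation leb := (@lebesgue_measure R).
Variables (m : R[i] -> R[i]) (rho : {measure set (measurableTypeR R) -> \bar R}).
Variables (A : R -> R) (W : (nat -> R -> R) -> R) (K : R) (N : nat).
Hypotheses (hrho : is_spectral_measure m rho) (K0 : 0 <= K) (KN : K + 2 <= N%:R).
Hypothesis mc : forall x : R, x < - K ^+ 2 ->
  derivable (m : R[i]^o -> R[i]^o) (x%:C : R[i]^o) 1 /\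
  m x%:C = (complex.Re (m x%:C))%:C.
Hypothesis iA : leb.-integrable `]0, +oo[
  (EFin \o (fun x => A x * expR (- (2 * N%:R * x)))).
Hypothesis bW : forall P, bounded_functional P N W.
Hypothesis mE : forall n, (N <= n)%N ->
  complex.Re (m (- n%:R ^+ 2)%:C) = - n%:R
    - Rintegral leb `]0, +oo[ (fun x => A x * expR (- (2 * n%:R * x)))
    - W (exp_jet n).

Local Notation D := (`[- K ^+ 2, +oo[%classic : set R).
Let P (F : nat -> R -> R) : Prop :=
  [/\ jet F, exists B, exp_bounded N B F & measurable_fun D (sin_trans F)].

(* Half the difference of the two sides of the theorem. The term in
   [F 0 0], absent there because test functions are odd, makes [T] vanish on
   exponentials. *)
Let T (F : nat -> R -> R) : R := Rintegral rho D (sin_trans F)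
  + 1 * Rintegral leb `]0, +oo[ (fun x => A x * F 0%N x)
  + - 2^-1 * F 1%N 0 + complex.Re (m (0 +i* 1)) * F 0%N 0 + 1 * W F.

(** The summands of [T] carry explicit factors, even [1], to fit [bounded_functional_comb]. *)
Let bT : bounded_functional P N T.
Proof.
apply: bounded_functional_comb => //.
apply: bounded_functional_comb; last exact: bounded_functional_eval.
apply: bounded_functional_comb; last exact: bounded_functional_eval.
apply: bounded_functional_comb; last exact: regular_bounded_functional.
apply: bounded_functional_sub (spectral_bounded_functional hrho K0 KN).
by move=> F [].
Qed.

(** The Herglotz constant cancels against [Re m(i) F(0)] with [F(0) = 1], and [- F'(0) / 2 = n]
    cancels the leading term [- n] of [m]; the rest is [mE]. *)
Let T_exp n : (N <= n)%N -> T (exp_jet n) = 0.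
Proof.
move=> Nn; rewrite /T (spectral_exp hrho K0 mc KN Nn).
rewrite mE//.
rewrite /exp_jet /= !mulr0 oppr0 expR0 expr0 expr1 !mulr1 !mul1r.
have -> : (fun x => A x * (1 * expR (- (2 * n%:R * x)))) =
  (fun x => A x * expR (- (2 * n%:R * x))) by apply/funext => x; rewrite mul1r.
by rewrite -/(exp_jet n); field.
Qed.

Lemma spectral_functional_eq (F : nat -> R -> R) (a : R) : jet F ->
  (forall i x, a <= x -> F i x = 0) -> T F = 0.
Proof.
move=> jF F0.
have N0 : (0 < N)%N.
  by rewrite -(ltr0n R); apply: lt_le_trans KN; have := K0; lra.
apply: (bounded_functional_eq0 jF F0 N0 _ _ bT T_exp).
- move=> k Nk; split; [exact: jet_exp|exact: exp_bounded_exp|].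
  exact: (sin_trans_measurable_exp K0 KN).
- move=> G H b [jG [B bG] mG] [jH [B' bH] mH]; split; first exact: jetD.
    by exists (B + `|b| * B'); exact: exp_boundedD.
  apply: (@eq_measurable_fun _ _ R R _ (fun l => sin_trans G l + b * sin_trans H l)).
    move=> l; rewrite inE/= in_itv/= andbT => Kl.
    by rewrite (sin_transD K0 KN _ jG jH bG bH Kl).
  by apply: measurable_funD => //; apply: measurable_funM => //; exact: measurable_cst.
- split=> //; first exact: jet_exp_bounded F0.
  by apply: measurable_funTS; exact: sin_trans_measurable F0.
Qed.

(** Twice the equation [T = 0]: oddness removes the term in [F 0 0], and the doubled half-line
    integral of [A] is the integral over the line against the odd extension of [A]. *)
Lemma real_identity (u : R -> R) (a : R) :
  (forall n (x : R), derivable (u^`(n))%classic x 1) ->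
  (forall x, a < x -> u x = 0) -> (forall x, u (- x) = - u x) ->
  let S l := Rintegral leb setT (fun x => u x * sin_kernel x l) in
  rho.-integrable setT (EFin \o S) /\
  - 2 * Rintegral rho setT S =
    Rintegral leb setT (fun x => (\1_(`]0, +oo[ : set R) x * A x
      - \1_(`]-oo, 0[ : set R) x * A (- x)) * u x)
    - (u^`())%classic 0 + 2 * W (derive_jet u).
Proof.
move=> su u0 uN S.
have jU := jet_derive su; have U0 := derive_jet_eq0 su u0.
have SE : S = sin_trans (derive_jet u).
  by apply/funext => l; exact: (sin_trans_odd su u0 uN).
have mS := sin_trans_measurable jU U0.
have [B bU] := jet_exp_bounded N jU U0.
have [iD _] := spectral_trans_integrable hrho K0 KN jU bU
  (measurable_funS measurableT (@subsetT _ _) mS).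
have [iS ES] := spectral_integral_half hrho mc mS iD.
rewrite SE; split=> //.
rewrite ES (regular_odd su u0 uN iA).
have := spectral_functional_eq jU U0; rewrite /T.
have -> : derive_jet u 0 0 = 0 by exact: odd_eq0 uN.
have -> : (fun x => A x * derive_jet u 0 x) = (fun x => A x * u x) by [].
have -> : derive_jet u 1 0 = (u^`())%classic 0 by [].
lra.
Qed.

End RealIdentity.

(** * Reduction of complex series and integrals to real ones *)

Section ComplexSeries.
Variable R : realType.
Local Notation Re := (@complex.Re R).
Local Notation Im := (@complex.Im R).

Lemma complex_eq (z w : R[i]) : Re z = Re w -> Im z = Im w -> z = w.
Proof. by case: z w => [x y] [x' y'] /= -> ->. Qed.

Lemma complex_ReD (z w : R[i]) : Re (z + w) = Re z + Re w.
Proof. by case: z w => [? ?] [? ?]. Qed.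

Lemma complex_ImD (z w : R[i]) : Im (z + w) = Im z + Im w.
Proof. by case: z w => [? ?] [? ?]. Qed.

Lemma complex_ReZ (r : R) (z : R[i]) : Re (r%:C * z) = r * Re z.
Proof. by case: z => [x y] /=; rewrite mul0r subr0. Qed.

Lemma complex_ImZ (r : R) (z : R[i]) : Im (r%:C * z) = r * Im z.
Proof. by case: z => [x y] /=; rewrite mul0r addr0. Qed.

Lemma cvg_complex (s : nat -> R[i]) (x y : R) :
  Re (s n) @[n --> \oo] --> x -> Im (s n) @[n --> \oo] --> y ->
  (s n : R[i]^o) @[n --> \oo] --> (x +i* y : R[i]^o).
Proof.
move=> sx sy; apply/cvgrPdist_le => -[e e'].
rewrite ltcE/= => /andP[/eqP e'0 e0].
have e2 : 0 < e / 2 by rewrite divr_gt0.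
move/cvgrPdist_le : sx => /(_ _ e2) sx; move/cvgrPdist_le : sy => /(_ _ e2) sy.
near=> n; apply: (le_trans (normc_le_ReIm _)).
rewrite complex_ReB complex_ImB lecE/= e'0 eqxx/=.
have h1 : `|x - Re (s n)| <= e / 2 by near: n; exact: sx.
have h2 : `|y - Im (s n)| <= e / 2 by near: n; exact: sy.
by lra.
Unshelve. all: by end_near. Qed.

Lemma cseriesE (a : nat -> R[i]) (x y : R) :
  \sum_(1 <= j < n) Re (a j) @[n --> \oo] --> x ->
  \sum_(1 <= j < n) Im (a j) @[n --> \oo] --> y ->
  cseries a = x +i* y.
Proof.
move=> sx sy; rewrite /cseries; apply: (@cvg_lim (R[i]^o)).
  exact: norm_hausdorff.
apply: cvg_complex.
  by under eq_fun do rewrite (big_morph Re complex_ReD erefl).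
by under eq_fun do rewrite (big_morph Im complex_ImD erefl).
Qed.

Lemma cseries_real (r : nat -> R) :
  \sum_(1 <= j < n) r j @[n --> \oo] --> rseries r ->
  cseries (fun j => (r j)%:C) = (rseries r)%:C.
Proof.
move=> rc; apply: cseriesE => //=.
by under eq_fun do rewrite big1//; exact: cvg_cst.
Qed.

Lemma cexp_real (x : R) : cexp x%:C = (expR x)%:C.
Proof. by rewrite /cexp /= cos0 sin0 mulr1 mulr0. Qed.

Lemma cintegral_real (mu : {measure set (measurableTypeR R) -> \bar R}) (E : set R)
  (g : R -> R) : cintegral mu E (fun x => (g x)%:C) = (Rintegral mu E g)%:C.
Proof.
apply: complex_eq => //=; rewrite /Rintegral.
have -> : (fun x => (Im_fun (fun x => (g x)%:C) x)%:E) = (fun=> 0%E :> \bar R) by [].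
by rewrite integral0.
Qed.

Lemma laplace_real (A : R -> R) (k : R) :
  laplace_integrand A k%:C = (fun x => (A x * expR (- (2 * k * x)))%:C).
Proof.
apply/funext => x; rewrite /laplace_integrand.
have -> : - 2%:R * x%:C * k%:C = (- (2 * k * x))%:C.
  by rewrite !(rmorphM, rmorphN) /= rmorph_nat mulrAC !mulNr.
by rewrite cexp_real -rmorphM.
Qed.

End ComplexSeries.

(** * Complex test functions *)

Section TestFunction.
Variable R : realType.
Local Notation leb := (@lebesgue_measure R).

Lemma test_function_eq0 (f : R -> R[i]) : test_function f ->
  exists a : R, forall x, a < x -> f x = 0.
Proof.
move=> [/compact_bounded [M [_ HM]] _].
exists (`|M| + 1) => x Mx; apply/eqP/negPn/negP => fx.
have M1 : M < `|M| + 1 by rewrite ltr_pwDr// ler_norm.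
have cx : closure [set x | f x != 0] x by exact: (@subset_closure _ [set x | f x != 0]).
have xM : `|x| <= `|M| + 1 := HM _ M1 x cx.
by have := ler_norm x; lra.
Qed.

Lemma Re_sin_transform (f : R -> R[i]) : Re_fun (sin_transform f) =
  fun l => Rintegral leb setT (fun x => Re_fun f x * sin_kernel x l).
Proof.
apply/funext => l; rewrite /Re_fun /sin_transform /cintegral /=.
by apply: eq_Rintegral => x _; rewrite /Re_fun mulrC complex_ReZ mulrC.
Qed.

Lemma Im_sin_transform (f : R -> R[i]) : Im_fun (sin_transform f) =
  fun l => Rintegral leb setT (fun x => Im_fun f x * sin_kernel x l).
Proof.
apply/funext => l; rewrite /Im_fun /sin_transform /cintegral /=.
by apply: eq_Rintegral => x _; rewrite /Im_fun mulrC complex_ImZ mulrC.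
Qed.

Variable f : R -> R[i].
Hypotheses (hf : test_function f) (f_odd : forall x, f (- x) = - f x).

Let Re_odd x : Re_fun f (- x) = - Re_fun f x.
Proof. by rewrite /Re_fun f_odd; case: (f x). Qed.

Let Im_odd x : Im_fun f (- x) = - Im_fun f x.
Proof. by rewrite /Im_fun f_odd; case: (f x). Qed.

Let Re_smooth n (x : R) : derivable ((Re_fun f)^`(n))%classic x 1.
Proof. by have [_ /(_ n x)[]] := hf. Qed.

Let Im_smooth n (x : R) : derivable ((Im_fun f)^`(n))%classic x 1.
Proof. by have [_ /(_ n x)[]] := hf. Qed.

Section Assembly.
Variables (m : R[i] -> R[i]) (rho : {measure set (measurableTypeR R) -> \bar R}).
Variables (A : R -> R) (W : (nat -> R -> R) -> R) (K : R) (N : nat).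
Hypotheses (hrho : is_spectral_measure m rho) (K0 : 0 <= K) (KN : K + 2 <= N%:R).
Hypothesis mc : forall x : R, x < - K ^+ 2 ->
  derivable (m : R[i]^o -> R[i]^o) (x%:C : R[i]^o) 1 /\
  m x%:C = (complex.Re (m x%:C))%:C.
Hypothesis iA : leb.-integrable `]0, +oo[
  (EFin \o (fun x => A x * expR (- (2 * N%:R * x)))).
Hypothesis bW : forall P, bounded_functional P N W.
Hypothesis mE : forall n, (N <= n)%N ->
  complex.Re (m (- n%:R ^+ 2)%:C) = - n%:R
    - Rintegral leb `]0, +oo[ (fun x => A x * expR (- (2 * n%:R * x)))
    - W (exp_jet n).

Lemma spectral_distr : cintegrable rho setT (sin_transform f) /\
  - 2%:R * cintegral rho setT (sin_transform f) =
  regular_distr (fun alpha => \1_(`]0, +oo[ : set R) alpha * A alpha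
                            - \1_(`]-oo, 0[ : set R) alpha * A (- alpha)) f
  + delta' 0 f
  + ((2 * W (derive_jet (Re_fun f))) +i* (2 * W (derive_jet (Im_fun f)))).
Proof.
have [a fa] := test_function_eq0 hf.
have [|iRe ERe] := real_identity hrho K0 KN mc iA bW mE Re_smooth _ Re_odd (a := a).
  by move=> x /fa; rewrite /Re_fun => ->.
have [|iIm EIm] := real_identity hrho K0 KN mc iA bW mE Im_smooth _ Im_odd (a := a).
  by move=> x /fa; rewrite /Im_fun => ->.
split.
  by split; rewrite ?Re_sin_transform ?Im_sin_transform.
have -> : - 2%:R = (- 2)%:C :> R[i] by rewrite rmorphN rmorph_nat.
apply: complex_eq.
  rewrite complex_ReZ !complex_ReD /= Re_sin_transform ERe; congr (_ + _).
  congr (_ + _); apply: eq_Rintegral => x _.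
  by rewrite complex_ReZ.
rewrite complex_ImZ !complex_ImD /= Im_sin_transform EIm; congr (_ + _).
congr (_ + _); apply: eq_Rintegral => x _.
by rewrite complex_ImZ.
Qed.

End Assembly.

Section FiniteTerms.
Variables (b C : R) (cA cB : nat -> R).
Hypotheses (b0 : 0 < b) (cAC : forall j, (0 < j)%N -> `|cA j| <= C * j%:R)
  (cBC : forall j, (0 < j)%N -> `|cB j| <= C * j%:R).

(** Half of the point masses of [A_tilde] away from 0, as they act on odd functions. On
    [exp (- 2 k x)] the factor [- 2^-1] meets the derivative's [- 2 k] and produces the [kappa] of
    the [A_coef] series in the representation of [m]. *)
Definition point_masses (F : nat -> R -> R) : R :=
  rseries (fun j => cB j * F 0%N (b * j%:R)) +
  - 2^-1 * rseries (fun j => cA j * F 1%N (b * j%:R)).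

Lemma point_masses_bounded P N : (0 < N)%N -> bounded_functional P N point_masses.
Proof.
move=> N0; apply: bounded_functional_comb.
  exact: (series_bounded_functional b0 N0 (isT : (0 <= 4)%N) cBC).
exact: (series_bounded_functional b0 N0 (isT : (1 <= 4)%N) cAC).
Qed.

(** For odd [u] the masses at [b j] and [- b j] contribute equally, since [u'] is even. *)
Let point_masses_odd (u : R -> R) (a : R) : (forall n (x : R), derivable (u^`(n))%classic x 1) ->
  (forall x, a < x -> u x = 0) -> (forall x, u (- x) = - u x) ->
  \sum_(1 <= j < n) cB j * (u (b * j%:R) - u (- (b * j%:R))) @[n --> \oo] -->
    2 * rseries (fun j => cB j * derive_jet u 0 (b * j%:R)) /\
  \sum_(1 <= j < n) 2^-1 * cA j * (- (u^`())%classic (b * j%:R)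
      - (u^`())%classic (- (b * j%:R))) @[n --> \oo] -->
    - 1 * rseries (fun j => cA j * derive_jet u 1 (b * j%:R)).
Proof.
move=> su u0 uN.
have [B bU] := jet_exp_bounded 1 (jet_derive su) (derive_jet_eq0 su u0).
split.
  have [c _] := series_functional_cvg b0 (isT : (0 < 1)%N) (isT : (0 <= 4)%N) cBC bU.
  have -> : (fun n => \sum_(1 <= j < n) cB j * (u (b * j%:R) - u (- (b * j%:R)))) =
    (fun n => 2 * \sum_(1 <= j < n) cB j * derive_jet u 0 (b * j%:R)).
    apply/funext => n; rewrite mulr_sumr; apply: eq_bigr => j _.
    by rewrite uN /derive_jet /=; ring.
  exact: cvgMr.
have [c _] := series_functional_cvg b0 (isT : (0 < 1)%N) (isT : (1 <= 4)%N) cAC bU.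
have -> : (fun n => \sum_(1 <= j < n) 2^-1 * cA j * (- (u^`())%classic (b * j%:R)
      - (u^`())%classic (- (b * j%:R)))) =
    (fun n => - 1 * \sum_(1 <= j < n) cA j * derive_jet u 1 (b * j%:R)).
  apply/funext => n; rewrite mulr_sumr; apply: eq_bigr => j _.
  by rewrite (derive1_odd su uN) -[derive_jet u 1]/(u^`())%classic; field.
exact: cvgMr.
Qed.

Let Re_delta' (c : R) : complex.Re (delta' c f) = - ((Re_fun f)^`())%classic c.
Proof. by []. Qed.

Let Im_delta' (c : R) : complex.Im (delta' c f) = - ((Im_fun f)^`())%classic c.
Proof. by []. Qed.

Lemma point_masses_distr :
  cseries (fun j => (cB j)%:C * (delta (b * j%:R) f - delta (- (b * j%:R)) f))
  + cseries (fun j => (2^-1 * cA j)%:C *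
      (delta' (b * j%:R) f + delta' (- (b * j%:R)) f)) =
  (2 * point_masses (derive_jet (Re_fun f))) +i*
  (2 * point_masses (derive_jet (Im_fun f))).
Proof.
have [a fa] := test_function_eq0 hf.
have [|ReB ReA] := point_masses_odd Re_smooth _ Re_odd (a := a).
  by move=> x /fa; rewrite /Re_fun => ->.
have [|ImB ImA] := point_masses_odd Im_smooth _ Im_odd (a := a).
  by move=> x /fa; rewrite /Im_fun => ->.
rewrite (cseriesE (x := 2 * rseries (fun j => cB j * derive_jet (Re_fun f) 0 (b * j%:R)))
  (y := 2 * rseries (fun j => cB j * derive_jet (Im_fun f) 0 (b * j%:R)))); last 2 first.
- apply: cvg_trans ReB; apply: near_eq_cvg; near=> n; apply: eq_bigr => j _.
  by rewrite complex_ReZ complex_ReB.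
- apply: cvg_trans ImB; apply: near_eq_cvg; near=> n; apply: eq_bigr => j _.
  by rewrite complex_ImZ complex_ImB.
rewrite (cseriesE (x := - 1 * rseries (fun j => cA j * derive_jet (Re_fun f) 1 (b * j%:R)))
  (y := - 1 * rseries (fun j => cA j * derive_jet (Im_fun f) 1 (b * j%:R)))); last 2 first.
- apply: cvg_trans ReA; apply: near_eq_cvg; near=> n; apply: eq_bigr => j _.
  by rewrite complex_ReZ complex_ReD !Re_delta'.
- apply: cvg_trans ImA; apply: near_eq_cvg; near=> n; apply: eq_bigr => j _.
  by rewrite complex_ImZ complex_ImD !Im_delta'.
by apply: complex_eq => /=; rewrite /point_masses; field.
Unshelve. all: by end_near. Qed.

Lemma point_masses_exp (k : R) : 1 <= k ->
  \sum_(1 <= j < n) cB j * expR (- (2 * k * (b * j%:R))) @[n --> \oo] -->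
    rseries (fun j => cB j * expR (- (2 * k * (b * j%:R)))) /\
  \sum_(1 <= j < n) cA j * expR (- (2 * k * (b * j%:R))) @[n --> \oo] -->
    rseries (fun j => cA j * expR (- (2 * k * (b * j%:R)))).
Proof.
(* This constant sequence is not a jet, but convergence of the series uses only the exponential
   bound, here with [N = 1] and [B = 1]. *)
move=> k1; have bF : @exp_bounded R 1 1 (fun _ x => expR (- (2 * k * x))).
  move=> i x _ x0; rewrite mul1r ger0_norm ?expR_ge0// ler_expR lerN2.
  by rewrite ler_wpM2r// ler_wpM2l.
split.
  by have [] := series_functional_cvg b0 (isT : (0 < 1)%N) (isT : (0 <= 4)%N) cBC bF.
by have [] := series_functional_cvg b0 (isT : (0 < 1)%N) (isT : (0 <= 4)%N) cAC bF.
Qed.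

End FiniteTerms.

End TestFunction.

(** * The representations of [m] at real points *)

Section MFunction.
Variable R : realType.
Local Notation leb := (@lebesgue_measure R).
Variables (q : R -> R) (m : R[i] -> R[i]) (A : R -> R).

Lemma m_function_derivable e : is_m_function e q m -> exists beta : R,
  forall x : R, x < beta -> derivable (m : R[i]^o -> R[i]^o) (x%:C : R[i]^o) 1.
Proof.
move=> [_ [beta mb]]; exists beta => x xb; apply: mb => -[_ /=].
by rewrite leNgt xb.
Qed.

Lemma sqr_real_complex (k : R) : - k%:C ^+ 2 = (- k ^+ 2)%:C.
Proof. by rewrite rmorphN rmorphXn. Qed.

Lemma m_real_infinite (k : R) : is_A_function Infinite q m A ->
  2^-1 * Rintegral leb (dom Infinite) (fun x => `|q x|) < k ->
  leb.-integrable `]0, +oo[ (EFin \o (fun x => A x * expR (- (2 * k * x)))) /\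
  m (- k ^+ 2)%:C =
    (- k - Rintegral leb `]0, +oo[ (fun x => A x * expR (- (2 * k * x))))%:C.
Proof.
move=> hA qk; have [[iA _]] := hA k%:C qk.
rewrite sqr_real_complex laplace_real cintegral_real => ->.
split; last by rewrite rmorphB rmorphN.
by move: iA; rewrite laplace_real.
Qed.

Lemma A_coef_le h j : (0 < j)%N -> `|A_coef h j : R| <= 2 * j%:R.
Proof.
move=> j0; have j1 : (1 : R) <= j%:R by rewrite ler1n.
rewrite /A_coef; case: h => [_|]; last by rewrite ger0_norm//; lra.
by rewrite normrM normrX normrN1 expr1n ger0_norm//; lra.
Qed.

Lemma B_coef_le b h : exists2 C, 0 <= C &
  forall j, `|B_coef q b h j| <= C * j%:R.
Proof.
rewrite /B_coef; case: h => [h|] /=; set Q := Rintegral _ _ _.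
  exists (2 * `|2 * h + Q|); first by rewrite mulr_ge0.
  move=> j; rewrite !normrM normrX normrN1 expr1n mulr1.
  by rewrite (ger0_norm (ler0n _ 2)) (ger0_norm (ler0n _ j)) mulrAC.
exists (2 * `|Q|); first by rewrite mulr_ge0.
move=> j; rewrite !normrM normrN.
by rewrite (ger0_norm (ler0n _ 2)) (ger0_norm (ler0n _ j)) mulrAC.
Qed.

Lemma rseriesMl (c : R) (r : nat -> R) :
  \sum_(1 <= j < n) r j @[n --> \oo] --> rseries r ->
  \sum_(1 <= j < n) c * r j @[n --> \oo] --> rseries (fun j => c * r j) /\
  rseries (fun j => c * r j) = c * rseries r.
Proof.
move=> rc; have H : \sum_(1 <= j < n) c * r j @[n --> \oo] --> c * rseries r.
  by under eq_fun do rewrite -mulr_sumr; exact: cvgMr.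
have E : rseries (fun j => c * r j) = c * rseries r by exact: cvg_lim H.
by rewrite E.
Qed.

(** At a real point every term is real; [1 <= k] gives the convergence needed to identify the
    complex limits with real ones. *)
Lemma m_real_finite (b : R) h : 0 < b -> is_A_function (Defs.Finite b h) q m A ->
  exists K : R, forall k : R, K < k -> 1 <= k ->
    m (- k ^+ 2)%:C =
    (- k - k * rseries (fun j => A_coef h j * expR (- (2 * k * (b * j%:R))))
     - rseries (fun j => B_coef q b h j * expR (- (2 * k * (b * j%:R))))
     - Rintegral leb `]0, +oo[ (fun x => A x * expR (- (2 * k * x))))%:C.
Proof.
move=> b0 [_ _ [K mK]]; exists K => k Kk k1.
have [C C0 BC] := B_coef_le b h.
have C2 : 0 <= C + 2 by rewrite addr_ge0.
have AC' j : (0 < j)%N -> `|A_coef h j : R| <= (C + 2) * j%:R.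
  by move=> /(A_coef_le h) /le_trans; apply; rewrite ler_wpM2r// lerDr.
have BC' j : (0 < j)%N -> `|B_coef q b h j| <= (C + 2) * j%:R.
  by move=> _; apply: (le_trans (BC j)); rewrite ler_wpM2r// lerDl.
have [cB cA] := point_masses_exp b0 AC' BC' k1.
have [ckA EkA] := rseriesMl k cA.
rewrite -sqr_real_complex (mK k%:C Kk).
have cexpE j : cexp (- 2%:R * k%:C * b%:C * j%:R) = (expR (- (2 * k * (b * j%:R))))%:C.
  rewrite -cexp_real; congr cexp.
  by rewrite !(rmorphM, rmorphN) /= !rmorph_nat !mulrA !mulNr.
have -> : (fun j => (A_coef h j)%:C * k%:C * cexp (- 2%:R * k%:C * b%:C * j%:R)) =
    (fun j => (k * (A_coef h j * expR (- (2 * k * (b * j%:R)))))%:C).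
  by apply/funext => j; rewrite cexpE -!rmorphM; congr (_%:C); ring.
have -> : (fun j => (B_coef q b h j)%:C * cexp (- 2%:R * k%:C * b%:C * j%:R)) =
    (fun j => (B_coef q b h j * expR (- (2 * k * (b * j%:R))))%:C).
  by apply/funext => j; rewrite cexpE -!rmorphM.
rewrite (cseries_real ckA) (cseries_real cB) laplace_real cintegral_real EkA.
by rewrite !rmorphB rmorphN.
Qed.

(** Every [x < - K ^ 2] is [- k ^ 2] with [k = sqrt (- x) > K]. *)
Lemma m_real_below (K : R) : 0 <= K ->
  (forall k, K < k -> exists w : R, m (- k ^+ 2)%:C = w%:C) ->
  forall x : R, x < - K ^+ 2 -> m x%:C = (complex.Re (m x%:C))%:C.
Proof.
move=> K0 mk x xK; have x0 : 0 < - x by have := sqr_ge0 K; lra.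
have [|w] := mk (Num.sqrt (- x)).
  by rewrite -[ltLHS](ger0_norm K0) -sqrtr_sqr ltr_sqrt// ltrNr.
by rewrite sqr_sqrtr ?opprK ?(ltW x0)// => ->.
Qed.

End MFunction.

Theorem theorem5p3 (R : realType) (e : right_end R) (q : R -> R)
    (m : R[i] -> R[i]) (rho : {measure set (measurableTypeR R) -> \bar R})
    (A : R -> R) (f : R -> R[i])
    (he : right_end_ok e)
    (hq : L1_potential e q)
    (hm : is_m_function e q m)
    (hrho : is_spectral_measure m rho)
    (hA : is_A_function e q m A)
    (hf : test_function f)
    (f_odd : forall alpha : R, f (- alpha) = - f alpha) :
  cintegrable rho setT (sin_transform f) /\
  - 2%:R * cintegral rho setT (sin_transform f) = A_tilde e q A f.
Proof.
have [beta mb] := m_function_derivable hm.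
(* [- K ^ 2 <= - (|beta| + 1) ^ 2 < beta], so such [x] lie to the left of the cut. *)
have below K x : `|beta| + 1 <= K -> x < - K ^+ 2 ->
    derivable (m : R[i]^o -> R[i]^o) (x%:C : R[i]^o) 1.
  move=> bK xK; apply: mb; have := ler_norm (- beta); rewrite normrN.
  by have := normr_ge0 beta; nra.
case: e he hq hm hA => [|b h] he hq hm hA.
  set Q := 2^-1 * Rintegral (@lebesgue_measure R) (dom Infinite) (fun x => `|q x|).
  (* [|Q|] brings the points [- k ^ 2], [k > K], into the range of the representation, and
     [|beta| + 1] brings them to the left of the cut of [m]. *)
  pose K := `|Q| + `|beta| + 1; pose N := (Num.trunc (K + 2)).+1.
  have KN : K + 2 <= N%:R by apply/ltW/truncnS_gt.
  have [Q0 beta0] := (normr_ge0 Q, normr_ge0 beta).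
  have K0 : 0 <= K by rewrite /K; lra.
  have QK k : K < k -> Q < k by have := ler_norm Q; rewrite /K; lra.
  have QN n : (N <= n)%N -> Q < n%:R.
    move=> Nn; apply: QK; have : (N%:R : R) <= n%:R by rewrite ler_nat.
    lra.
  have mc x : x < - K ^+ 2 -> derivable (m : R[i]^o -> R[i]^o) (x%:C : R[i]^o) 1 /\
      m x%:C = (complex.Re (m x%:C))%:C.
    move=> xK; split; first by apply: below xK; rewrite /K; lra.
    apply: (m_real_below K0 _ xK) => k /QK Qk.
    by have [_ ->] := m_real_infinite hA Qk; eexists.
  have [iA _] := m_real_infinite hA (QN N (leqnn N)).
  (* For [b = oo] there are no endpoint terms, so [W] is zero. *)
  have bW P : @bounded_functional R P N (fun _ => 0).
    split; first by exists 0 => // F B _ _ _; rewrite normr0 mul0r.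
    by move=> *; rewrite mulr0 addr0.
  have [n Nn|i ->] := spectral_distr hf f_odd hrho K0 KN mc iA bW.
    by have [_ ->] := m_real_infinite hA (QN n Nn); rewrite subr0.
  by split=> //; rewrite /A_tilde mulr0.
have [C C0 BC] := B_coef_le q b h.
have C2 : 0 <= C + 2 by rewrite addr_ge0.
have cA j : (0 < j)%N -> `|A_coef h j : R| <= (C + 2) * j%:R.
  by move=> /(A_coef_le h) /le_trans; apply; rewrite ler_wpM2r// lerDr.
have cB j : (0 < j)%N -> `|B_coef q b h j| <= (C + 2) * j%:R.
  by move=> _; apply: (le_trans (BC j)); rewrite ler_wpM2r// lerDl.
have [K1 mK] := m_real_finite he hA.
case: (hA) => [iA [Cg [Kg AC]] _].
(* [|K1|] serves the representation of [m], [|Kg|] the growth of [A], and the summand 1 ensures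
   [1 <= k], under which the series converge. *)
pose K := `|K1| + `|Kg| + `|beta| + 1; pose N := (Num.trunc (K + 2)).+1.
have KN : K + 2 <= N%:R by apply/ltW/truncnS_gt.
have [[K10 Kg0] beta0] := (normr_ge0 K1, normr_ge0 Kg, normr_ge0 beta).
have K0 : 0 <= K by rewrite /K; lra.
have mK' k : K < k -> 1 <= k /\ K1 < k.
  by have := ler_norm K1; rewrite /K => ? ?; split; lra.
have mc x : x < - K ^+ 2 -> derivable (m : R[i]^o -> R[i]^o) (x%:C : R[i]^o) 1 /\
    m x%:C = (complex.Re (m x%:C))%:C.
  move=> xK; split; first by apply: below xK; rewrite /K; lra.
  apply: (m_real_below K0 _ xK) => k /mK'[k1 Kk].
  by rewrite mK//; eexists.
have iAN : (@lebesgue_measure R).-integrable `]0, +oo[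
    (EFin \o (fun x => A x * expR (- (2 * N%:R * x)))).
  by apply: growth_laplace_integrable iA AC _; move: KN; rewrite /K; lra.
have N0 : (0 < N)%N by [].
have bW P := point_masses_bounded he cA cB P N0.
have [n Nn|i ->] := spectral_distr hf f_odd hrho K0 KN mc iAN bW; last first.
  by split=> //; rewrite /A_tilde -(point_masses_distr hf f_odd he cA cB).
have [] := mK' n%:R; first by have : (N%:R : R) <= n%:R by [rewrite ler_nat]; lra.
move=> n1 Kn; rewrite mK//=; have [_ cAn] := point_masses_exp he cA cB n1.
rewrite /point_masses.
(* The factor [- 2 n] of the first derivative and the [- 2^-1] in [point_masses] combine to the [n]
   in front of the [A_coef] series. *)
have -> : (fun j => A_coef h j * exp_jet n 1 (b * j%:R)) =
  (fun j => - (2 * n%:R) * (A_coef h j * expR (- (2 * n%:R * (b * j%:R))))).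
  by apply/funext => j; rewrite /exp_jet expr1; ring.
have [_ ->] := rseriesMl (- (2 * n%:R)) cAn.
have -> : (fun j => B_coef q b h j * exp_jet n 0 (b * j%:R)) =
  (fun j => B_coef q b h j * expR (- (2 * n%:R * (b * j%:R)))).
  by apply/funext => j; rewrite /exp_jet expr0 mul1r.
by field.
Qed.
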